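(* Let $n>4$. There exists an orientation of the edges of the flip graph $\Gamma_n$ such that, for every oriented edge $(T,S)$ of adjacent colored triangulations (oriented from $T$ to $S$) and every diagonal $[i,j]$ of the $n$-gon, $S$ is obtained from $T$ by flipping the diagonal $[i,j]$ (that is, the chord $[i,j]$ of $T$ is the one erased and replaced) if and only if the chambers of $\mathcal{A}(K'_n)$ corresponding to $T$ and $S$ are separated by the hyperplane $x_i=x_j$ (indices read modulo $n$ in $\{1,\ldots,n\}$).
   Context: Triangulations. Label the vertices of a convex $n$-gon $P_n$ cyclically by the elements $0,1,\ldots,n-1$ of $\mathbb{Z}_n$. Triangulations of $P_n$ have no extra vertices. Edges of the polygon are external edges; all other edges of a triangulation are internal edges, or chords; $[i,j]$ denotes the segment joining vertices $i$ and $j$. A triangulation is triangle-free if it contains no triangle with three internal edges. A chord is short if it connects vertices $i-1$ and $i+1$ for some $i\in\mathbb{Z}_n$; a triangle-free triangulation contains exactly two short chords. A proper coloring of a triangle-free triangulation is a labeling of its $n-3$ chords by $0,\ldots,n-4$ (each label used once) such that one of the short chords is labeled $0$ and, whenever a triangle has exactly two internal edges, their labels are consecutive integers $i,i+1$. $CTFT(n)$ is the set of all properly colored triangle-free triangulations of $P_n$. Each chord is a diagonal of a unique quadrangle (the union of the two adjacent triangles); replacing the chord by the other diagonal of that quadrangle is a flip of the chord; in a colored triangulation the new diagonal receives the label of the flipped one. The colored flip graph $\Gamma_n$ has vertex set $CTFT(n)$; two elements are joined by an edge if one is obtained from the other by a flip of a chord. Arc permutations. $S_n$ is the symmetric group on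 $\{1,\ldots,n\}$, and the letter $n$ is identified with $0\in\mathbb{Z}_n$. An interval in $\mathbb{Z}_n$ is a subset $\{i,i+1,\ldots,i+k\}$ (addition modulo $n$). $\pi=[\pi(1),\ldots,\pi(n)]\in S_n$ is an arc permutation if for every $1\le k\le n$ the set $\{\pi(1),\ldots,\pi(k)\}$ is an interval in $\mathbb{Z}_n$. $U_n$ is the set of arc permutations. $\tilde K'_n$-equivalence on $U_n$ is the transitive closure of the relation: two letters that are either $j,j+1$ for some $1\le j<n$, or $1,n$, occupy adjacent positions in $\pi$, and $\tau$ is obtained from $\pi$ by switching their positions. $U'_n$ is the set of equivalence classes. Each class consists of the four permutations obtained from one another by switching the first two letters and/or the last two letters, so it is represented by a sequence of $n-2$ subsets $\{\pi(1),\pi(2)\},\{\pi(3)\},\ldots,\{\pi(n-2)\},\{\pi(n-1),\pi(n)\}$. Arrangements. Let $W=\{\bar x\in\mathbb{R}^n: x_1+\cdots+x_n=0\}$, $H_{ij}=\{\bar x\in W: x_i=x_j\}$, and $c_\pi=\{\bar x\in W: x_{\pi(1)}<\cdots<x_{\pi(n)}\}$ for $\pi\in S_n$. $K'_n$ is the graph obtained from the complete graph on $\{1,\ldots,n\}$ by deleting the edges $\{1,2\},\ldots,\{n-1,n\},\{n,1\}$, and $\mathcal{A}(K'_n)=\{H_{ij}:\{i,j\}\text{ is an edge of }K'_n\}$. Its chambers are the connected components of the complement in $W$ of the union of its hyperplanes. Correspondence. Let $f:CTFT(n)\to U'_n$ be the bijection defined as follows. If $[a,a+2]$ is the short chord of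 $T$ labeled $0$, the first subset of $f(T)$ is $\{a,a+1\}$. For $1\le i\le n-4$, if the chord labeled $i-1$ is $[a-k,a+m]$ with $k\ge 0$, $m\ge 2$, $k+m=i+1$, then the chord labeled $i$ is either $[a-k-1,a+m]$ or $[a-k,a+m+1]$; the $(i+1)$-st subset of $f(T)$ is $\{a-k-1\}$ in the former case and $\{a+m\}$ in the latter. The last subset consists of the remaining two letters. The chamber of $\mathcal{A}(K'_n)$ corresponding to $T$ is the chamber containing $c_\pi$ for any $\pi\in f(T)$ (it does not depend on the choice of $\pi$ in the class). *)

(* Defs.v *)
From HB Require Import structures.
From mathcomp Require Import all_boot all_order all_algebra all_fingroup.
From mathcomp Require Import all_classical all_reals all_analysis.

Set Implicit Arguments.
Unset Strict Implicit.
Unset Printing Implicit Defensive.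

Import Order.TTheory GRing.Theory Num.Theory.
Import numFieldNormedType.Exports.

Local Open Scope classical_set_scope.
Local Open Scope ring_scope.

(* Vertices of the n-gon, letters of permutations and coordinates of R^n are  *)
(* all indexed by 'Z_n, the residue 0 standing for the letter n. 'Z_n is      *)
(* Z/nZ only for n > 1; everything below is meant for n > 4. The comparisons  *)
(* marked %N on elements of 'Z_n are between representatives in 0, .., n-1.   *)
(* The segment [i,j] is the set {i, j}.                                       *)

Definition external (n : nat) (D : {set 'Z_n}) : bool :=
  [exists i : 'Z_n, D == [set i; i + 1]%SET].

Definition polygon_diagonal (n : nat) (i j : 'Z_n) : bool :=
  (i != j) && ~~ external [set i; j]%SET.

Definition is_diagonal (n : nat) (D : {set 'Z_n}) : bool :=
  [exists i : 'Z_n, exists j : 'Z_n, polygon_diagonal i j && (D == [set i; j]%SET)].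

Definition short (n : nat) (D : {set 'Z_n}) : bool :=
  [exists i : 'Z_n, D == [set i - 1; i + 1]%SET].

(* Diagonals of a convex polygon meet in their interiors iff their endpoints  *)
(* strictly interleave; this is used for both orders of the two segments.     *)
Definition crossing (n : nat) (D E : {set 'Z_n}) : bool :=
  [exists a : 'Z_n, exists b : 'Z_n, exists c : 'Z_n, exists d : 'Z_n,
    [&& (a < b)%N, (b < c)%N, (c < d)%N,
        D == [set a; c]%SET & E == [set b; d]%SET]].

Definition noncrossing (n : nat) (A : {set {set 'Z_n}}) : bool :=
  [forall D in A, is_diagonal D]
  && [forall D in A, forall E in A, ~~ crossing D E].

Definition triangulation (n : nat) (A : {set {set 'Z_n}}) : bool :=
  maxset (@noncrossing n) A.

Definition sides (n : nat) (t : {set 'Z_n}) : {set {set 'Z_n}} :=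
  [set D : {set 'Z_n} | (D \subset t) && (#|D| == 2%N)]%SET.

Definition triangles (n : nat) (A : {set {set 'Z_n}}) : {set {set 'Z_n}} :=
  [set t : {set 'Z_n} | (#|t| == 3%N) &&
    [forall D in sides t, external D || (D \in A)]]%SET.

Definition triangle_free (n : nat) (A : {set {set 'Z_n}}) : bool :=
  [forall t in triangles A, #|sides t :&: A| != 3%N].

(* A labeling of n-3 chords by 0, .., n-4, each label being used once, is the *)
(* list of the chords by increasing label: nth finset.set0 T i is the chord labeled  *)
(* i, and index D T is the label of the chord D.                              *)
Definition coloring (n : nat) : Type := (n - 3).-tuple {set 'Z_n}.

Definition chords (n : nat) (T : coloring n) : {set {set 'Z_n}} :=
  [set D | D \in (T : seq _)]%SET.

Definition consecutive (i j : nat) : bool := (j == i.+1) || (i == j.+1).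

Definition properly_colored (n : nat) (T : coloring n) : bool :=
  [&& uniq T,
      short (nth finset.set0 T 0) &
      [forall t in triangles (chords T), (#|sides t :&: chords T| == 2%N) ==>
        [forall D in sides t :&: chords T, forall E in sides t :&: chords T,
          (D != E) ==> consecutive (index D T) (index E T)]]].

Definition CTFT (n : nat) : pred (coloring n) := fun T =>
  [&& triangulation (chords T), triangle_free (chords T)
    & properly_colored T].

(* t and u are the triangles on both sides of the chord D, t :|: u is the set *)
(* of vertices of the quadrangle and (t :|: u) :\: D its other diagonal.      *)
Definition flip (n : nat) (T : coloring n) (D : {set 'Z_n}) (S : coloring n) :
  bool :=
  (D \in chords T) &&
  [exists t in triangles (chords T), exists u in triangles (chords T),
    [&& t != u, D \subset t, D \subset u &
        (S : seq _) == set_nth finset.set0 T (index D T) ((t :|: u) :\: D)%SET]].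

Definition flip_graph (n : nat) : rel (coloring n) := fun T S =>
  [&& CTFT T, CTFT S &
      [exists D : {set 'Z_n}, flip T D S || flip S D T]].

Definition orientation (V : Type) (e o : rel V) : Prop :=
  (forall x y, o x y -> e x y) /\ (forall x y, e x y -> o x y (+) o y x).

(* Positions in a permutation are counted from 0. *)

Definition interval_Z (n : nat) (A : {set 'Z_n}) : bool :=
  [exists i : 'Z_n, exists k : 'Z_n,
    A == [set i + l | l : 'Z_n & (l <= k)%N]%SET].

Definition arc_perms (n : nat) : {set {perm 'Z_n}} :=
  [set pi : {perm 'Z_n} |
    [forall k : 'Z_n, interval_Z [set pi p | p : 'Z_n & (p <= k)%N]%SET]]%SET.

(* The pairs of letters j, j+1 (1 <= j < n) and 1, n are the pairs j, j+1 of  *)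
(* elements of Z/nZ.                                                          *)
Definition Kswitch (n : nat) : rel {perm 'Z_n} := fun pi tau =>
  [&& pi \in arc_perms n, tau \in arc_perms n &
    [exists p : 'Z_n, exists j : 'Z_n,
      [&& (p.+1 < n)%N, [set pi p; pi (p + 1)]%SET == [set j; j + 1]%SET
        & tau == (tperm p (p + 1) * pi)%g]]].

Definition arc_classes (n : nat) : {set {set {perm 'Z_n}}} :=
  equivalence_partition (connect (@Kswitch n)) (arc_perms n).

Definition blocks (n : nat) (pi : {perm 'Z_n}) : seq {set 'Z_n} :=
  [set pi 0; pi 1]%SET
  :: rcons [seq [set pi p%:R]%SET | p <- iota 2 (n - 4)]
           [set pi (n - 2)%:R; pi (n - 1)%:R]%SET.

(* The vertex a such that the chord labeled 0 is [a, a+2]; unique if n > 4. *)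
Definition base (n : nat) (T : coloring n) : 'Z_n :=
  odflt 0 [pick a : 'Z_n | nth finset.set0 T 0 == [set a; a + 2%:R]%SET].

Definition goes_left (n : nat) (T : coloring n) (i k m : nat) : bool :=
  nth finset.set0 T i == [set base T - k%:R - 1; base T + m%:R]%SET.

(* The pair (k, m) such that the chord labeled i is [a-k, a+m]. *)
Fixpoint chord_ends (n : nat) (T : coloring n) (i : nat) : nat * nat :=
  if i is i'.+1 then
    let: (k, m) := chord_ends T i' in
    if goes_left T i k m then (k.+1, m) else (k, m.+1)
  else (0%N, 2%N).

Definition letter (n : nat) (T : coloring n) (i : nat) : 'Z_n :=
  let: (k, m) := chord_ends T i.-1 in
  if goes_left T i k m then base T - k%:R - 1 else base T + m%:R.

Definition word (n : nat) (T : coloring n) : seq {set 'Z_n} :=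
  let w := [set base T; base T + 1]%SET
           :: [seq [set letter T i]%SET | i <- iota 1 (n - 4)] in
  rcons w (~: \bigcup_(A <- w) A)%SET.

(* The equivalence class represented by word T; the default set0 is not used  *)
(* when T is in CTFT n and n > 4.                                             *)
Definition perm_class (n : nat) (T : coloring n) : {set {perm 'Z_n}} :=
  odflt finset.set0
    [pick C in arc_classes n | [forall pi in C, blocks pi == word T]].

Definition W (R : realType) (n : nat) : set 'rV[R]_(Zp_trunc n).+2 :=
  [set x | \sum_(i : 'Z_n) x ord0 i = 0].
Arguments W : clear implicits.

Definition hyperplane (R : realType) (n : nat) (i j : 'Z_n) :
  set 'rV[R]_(Zp_trunc n).+2 := [set x | W R n x /\ x ord0 i = x ord0 j].
Arguments hyperplane R {n} i j _.

Definition cone (R : realType) (n : nat) (pi : {perm 'Z_n}) :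
  set 'rV[R]_(Zp_trunc n).+2 :=
  [set x | W R n x /\ forall p q : 'Z_n, (p < q)%N ->
                  x ord0 (pi p) < x ord0 (pi q)].
Arguments cone R {n} pi _.

(* {i,j} is an edge of K'_n iff [i,j] is a diagonal of the n-gon. *)
Definition arrangement (R : realType) (n : nat) :
  set (set 'rV[R]_(Zp_trunc n).+2) :=
  [set H | exists i j : 'Z_n, polygon_diagonal i j /\ H = hyperplane R i j].
Arguments arrangement : clear implicits.

Definition arr_complement (R : realType) (n : nat) :
  set 'rV[R]_(Zp_trunc n).+2 :=
  W R n `\` \bigcup_(H in arrangement R n) H.
Arguments arr_complement : clear implicits.

Definition chambers (R : realType) (n : nat) :
  set (set 'rV[R]_(Zp_trunc n).+2) :=
  [set connected_component (arr_complement R n) x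
    | x in arr_complement R n].
Arguments chambers : clear implicits.

(* The chamber containing the cones of all pi in perm_class T; it exists and  *)
(* is unique when T is in CTFT n and n > 4.                                   *)
Definition chamber_of (R : realType) (n : nat) (T : coloring n) :
  set 'rV[R]_(Zp_trunc n).+2 :=
  xget set0 [set C | chambers R n C /\
                     forall pi, pi \in perm_class T -> cone R pi `<=` C].
Arguments chamber_of R {n} T _.

Definition separated_by (R : realType) (n : nat) (i j : 'Z_n)
    (C D : set 'rV[R]_(Zp_trunc n).+2) : Prop :=
  (C `<=` [set x | x ord0 i < x ord0 j] /\ D `<=` [set x | x ord0 j < x ord0 i])
  \/
  (C `<=` [set x | x ord0 j < x ord0 i] /\ D `<=` [set x | x ord0 i < x ord0 j]).

(* Main.v *)
Require Import Defs.
From mathcomp Require Import all_boot all_order all_algebra all_fingroup.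
From mathcomp Require Import zify.

(** The chords of a properly coloured triangle-free triangulation T grow like a
    chain: chord j cuts off an arc of j + 3 consecutive vertices, and the next
    chord cuts off this arc enlarged by one neighbouring vertex. Leaving out the
    last vertex, chord j is recorded by the half-open arc A_j = [lo j, hi j) of
    j + 2 vertices, where lo j and hi j are the ends of the chord; the arcs A_j
    increase with j, each by one vertex on the left or on the right
    ([chord_endsP], [lo_chain]). This rests on the triangle behind a chord
    ([far_vertex], by maximality of T): its other two sides cannot both be
    internal, one of them is unless the chord is the last one, and the colouring
    forces the label of that side ([next_chord]).

    The word of T is A_0, then the successive differences of the A_j, then the
    complement of the last one. Hence the first letters of any permutation in
    the class of T form the sets A_j, and for a diagonal {u, v} of the polygon u
    comes before v exactly when some A_j contains u and not v: this is the
    relation [before]. The two letters of the first block, or of the last one,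
    are neighbours in the polygon, so a diagonal never has both ends in a block.
    The chamber of T is connected and avoids the hyperplanes of all diagonals,
    and it meets the cone of such a permutation; so x_u < x_v on the whole
    chamber when u comes before v ([chamber_side]), and two chambers are
    separated by x_u = x_v exactly when their words order u and v differently.

    A flip replaces one chord of the chain, say chord i, and keeps the others.
    The arcs on the other chords are then the same for both triangulations
    ([chain_agree]), and the arc A_i is shifted by one step, from [p, q) to
    [p + 1, q + 1) or the other way round ([chain_flip_shift]). The earlier
    arcs lie in [p + 1, q) and the later ones contain [p, q + 1), so the only
    diagonal whose ends change their order is {p, q} ([before_shift_lost],
    [before_shift_gained]). This diagonal is the chord with arc [p, q), which is
    the flipped chord on exactly one of the two sides of the edge ([flip_wall]).
    Each edge is oriented so as to leave that side. *)

Set Implicit Arguments.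
Unset Strict Implicit.
Unset Printing Implicit Defensive.
Import GRing.Theory.

(** * Cyclic distances *)

Section Polygon.
Local Open Scope ring_scope.
Variable n : nat.
Hypothesis n_gt4 : (4 < n)%N.

(** The number of steps from p to x in the increasing cyclic direction. *)
Definition off (p x : 'Z_n) : nat := (x - p)%R.

Lemma Zn_lt (x : 'Z_n) : (x < n)%N.
Proof. by rewrite -[X in (_ < X)%N](@Zp_cast n) ?ltn_ord //; lia. Qed.

Lemma off_lt p x : (off p x < n)%N. Proof. exact: Zn_lt. Qed.

Lemma val_natZ k : (k < n)%N -> (k%:R : 'Z_n) = k :> nat.
Proof. by move=> kn; rewrite val_Zp_nat ?modn_small //; lia. Qed.

Lemma off_val p x : off p x = if (p <= x)%N then (x - p)%N else (x + n - p)%N.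
Proof.
have xn := Zn_lt x; have pn := Zn_lt p.
rewrite /off /=; move: (nat_of_ord x) (nat_of_ord p) xn pn => {x p} x p xn pn.
rewrite (@Zp_cast n) ?modnDmr; last lia.
case: leqP => h; last by rewrite modn_small; lia.
rewrite (_ : (x + (n - p) = (x - p) + n)%N); last lia.
by rewrite modnDr modn_small; lia.
Qed.

Lemma offK p x : p + (off p x)%:R = x.
Proof. by rewrite natr_Zp addrC subrK. Qed.

Lemma off_addn p k : (k < n)%N -> off p (p + k%:R) = k.
Proof. by move=> kn; rewrite /off addrAC subrr add0r val_natZ. Qed.

Lemma off_inj p : injective (off p).
Proof. by move=> x y e; rewrite -(offK p x) -(offK p y) e. Qed.

Lemma off_id p : off p p = 0%N.
Proof. by rewrite /off subrr. Qed.

(** Distances from one base point determine those from any other. This turns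
    statements on cyclic order into linear arithmetic on distances. *)
Lemma off_base p q x :
  off q x = if (off p q <= off p x)%N then (off p x - off p q)%N
            else (off p x + n - off p q)%N.
Proof.
have := Zn_lt p; have := Zn_lt q; have := Zn_lt x; rewrite !off_val.
by case: (leqP q x); case: (leqP p q); case: (leqP p x) => ? ? ?;
  case: ifP; lia.
Qed.

Lemma off_add1 p x : off p (x + 1) = if off p x == n.-1 then 0%N else (off p x).+1.
Proof.
have xn := off_lt p x.
rewrite -{1}(offK p x) -addrA natr1; case: eqP => e.
  by rewrite e prednK ?pchar_Zp ?addr0 ?off_id //; lia.
by rewrite off_addn //; lia.
Qed.

Lemma off_sub1 p x : off p (x - 1) = if off p x == 0%N then n.-1 else (off p x).-1.
Proof.
have e := off_add1 p (x - 1); rewrite subrK in e; rewrite e.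
by have := off_lt p (x - 1); case: (off p (x - 1) =P n.-1) => [->|].
Qed.

Lemma polygon_diagonal_off p q :
  polygon_diagonal p q = (1 < off p q)%N && (off p q < n.-1)%N.
Proof.
have E x : off p x = 0%N -> x = p by move=> e; apply: (@off_inj p); rewrite off_id.
rewrite /polygon_diagonal; apply/andP/andP.
- case=> pq /existsP; rewrite -/(external _) => ne.
  have qn := off_lt p q.
  have q0 : off p q <> 0%N by move/E => e; rewrite e eqxx in pq.
  split; rewrite ltnNge; apply/negP => h; apply: ne.
    exists p; apply/eqP; congr [set _; _]%SET; apply: (@off_inj p).
    rewrite off_add1 off_id; case: eqP; lia.
  exists q; rewrite finset.setUC; apply/eqP; congr [set _; _]%SET.
  by apply: (@off_inj p); rewrite off_add1 off_id; case: eqP; lia.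
- case=> h1 h2; split; first by apply/eqP => e; rewrite -e off_id in h1.
  apply/existsP => -[i /eqP /setP e].
  have := e p; have := e q; have := e i; have := e (i + 1).
  rewrite !inE !eqxx ?orbT /=.
  move=> _ _ /esym /orP [] /eqP qi /esym /orP [] /eqP pi; move: h1 h2;
   rewrite ?qi ?pi ?off_id ?off_add1 ?off_id //; try by case: eqP; lia.
  have -> : off (i + 1) i = n.-1 by rewrite -[X in off _ X](addrK 1 i) off_sub1 off_id.
  lia.
Qed.
End Polygon.

(** * Chains of arcs and the order they define *)

Section Chains.
Local Open Scope ring_scope.
Variable n : nat.
Hypothesis n_gt4 : (4 < n)%N.
Implicit Types (p q u v x : 'Z_n) (lo : nat -> 'Z_n).

Lemma off_next p x :
  off (p + 1) x = if off p x == 0%N then n.-1 else (off p x).-1.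
Proof.
have xn := off_lt n_gt4 p x.
rewrite (off_base n_gt4 p) (off_add1 n_gt4) (off_id p).
have -> : (0%N == n.-1) = false by apply/eqP; lia.
by case: ltnP => h; case: eqP; lia.
Qed.

Lemma polygon_diagonal_base p u v :
  polygon_diagonal u v = (if (off p u <= off p v)%N
     then (off p u).+1 < off p v < (off p u + n).-1
     else (off p v).+1 < off p u < (off p v + n).-1)%N.
Proof.
have un := off_lt n_gt4 p u; have vn := off_lt n_gt4 p v.
rewrite (polygon_diagonal_off n_gt4) (off_base n_gt4 p).
by case: (leqP (off p u) (off p v)) => ?; apply/idP/idP; lia.
Qed.

Definition half_arc p (s : nat) : {set 'Z_n} := [set x : 'Z_n | (off p x < s)%N]%SET.

Lemma in_half_arc p s x : (x \in half_arc p s) = (off p x < s)%N.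
Proof. by rewrite inE. Qed.

(** A chain of arcs is given by the left ends lo j of the arcs [lo j, hi j) with
    j + 2 elements; lo j and hi j are then the ends of the chord labelled j. *)
Definition hi lo (j : nat) : 'Z_n := lo j + j.+2%:R.

Definition chain lo := forall j, (j.+1 < n - 3)%N ->
  lo j.+1 = lo j \/ lo j.+1 = lo j - 1.

(** Some arc of the chain separates u from v, with u inside: the order in which
    the letters u and v are met when the arcs are filled one after the other.
    Letters of the first block, and those of the last, are not compared. *)
Definition before lo u v : bool :=
  [exists j : 'I_(n - 3), (u \in half_arc (lo j) j.+2) && (v \notin half_arc (lo j) j.+2)].

Lemma beforeP lo u v : reflect
  (exists j, [/\ (j < n - 3)%N, (off (lo j) u < j.+2)%N & (j.+2 <= off (lo j) v)%N])
  (before lo u v).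
Proof.
apply: (iffP existsP) => [[j]|[j [jn ju jv]]].
  by rewrite !in_half_arc -leqNgt => /andP[]; exists j.
by exists (Ordinal jn); rewrite !in_half_arc -leqNgt ju.
Qed.

Lemma add1_neq p : p + 1 <> p.
Proof.
move/(congr1 (off p)); rewrite (off_add1 n_gt4) off_id; case: eqP; lia.
Qed.

Lemma add1_sub1_neq p : p + 1 <> p - 1.
Proof.
move/(congr1 (off p)); rewrite (off_add1 n_gt4) (off_sub1 n_gt4) off_id /=.
by case: eqP; lia.
Qed.

(** Two chains that differ by a shift at i and agree at i + 1 have there the
    union of the two arcs, which starts at the smaller left end. *)
Lemma chain_shift_next lo lo' i : chain lo -> chain lo' -> (i.+1 < n - 3)%N ->
  lo i.+1 = lo' i.+1 -> lo' i = lo i + 1 -> lo i.+1 = lo i.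
Proof.
move=> c c' i_n e s; have := c _ i_n; have := c' _ i_n; rewrite -e s addrK.
case=> // ->; case=> h; first by case: (@add1_neq (lo i)).
by case: (@add1_sub1_neq (lo i)).
Qed.

(** Likewise, the common arc at i is the intersection of the two arcs at i + 1. *)
Lemma chain_shift_prev lo lo' i : chain lo -> chain lo' -> (i.+1 < n - 3)%N ->
  lo i = lo' i -> lo' i.+1 = lo i.+1 + 1 -> lo i = lo i.+1 + 1.
Proof.
move=> c c' i_n e s; have := c _ i_n; have := c' _ i_n; rewrite -e s.
case=> // h; case=> h2; last by rewrite h2 subrK.
by move: h; rewrite h2 => /add1_sub1_neq.
Qed.

(** Two chains that agree except at i, where the arc is [p, q) in the first and
    [p + 1, q + 1) in the second, with p = lo i and q = hi lo i. *)
Section Shift.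
Variables (lo lo' : nat -> 'Z_n) (i : nat).
Hypotheses (c : chain lo) (c' : chain lo') (i_n : (i < n - 3)%N).
Hypothesis agree : forall j, (j < n - 3)%N -> j <> i -> lo j = lo' j.
Hypothesis shift : lo' i = lo i + 1.

Lemma off_hi : off (lo i) (hi lo i) = i.+2.
Proof. by rewrite /hi off_addn //; lia. Qed.

(** Only arc i can see the difference, so u = p or v = q. If u = p, the next arc
    [p, q + 1) leaves v = q as the only option; when there is no next arc, v is
    one of the two last letters, the other one being a neighbour of p. If v = q,
    the previous arc [p + 1, q) forces u = p; when there is none, the only other
    letter of arc i is a neighbour of q. *)
Lemma before_shift_lost u v : polygon_diagonal u v ->
  before lo u v -> ~~ before lo' u v -> u = lo i /\ v = hi lo i.
Proof.
set p := lo i; rewrite (polygon_diagonal_base p) => duv /beforeP [j [j_n ju jv]] /beforeP nb.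
have ji : j = i.
  by case: (j =P i) => // ji; case: nb; exists j; rewrite -(agree j_n ji).
subst j.
have un := off_lt n_gt4 p u; have vn := off_lt n_gt4 p v.
suff [ua vb] : off p u = 0%N /\ off p v = i.+2.
  by split; apply: (@off_inj n p); rewrite ?off_id ?off_hi.
have ati : off p u = 0%N \/ off p v = i.+2.
  case: (off p u =P 0%N) => [|u0]; first by left.
  case: (off p v =P i.+2) => [|v0]; first by right.
  case: nb; exists i; rewrite i_n shift !off_next -/p; split=> //;
    by case: eqP; rewrite -/p in ju jv *; lia.
rewrite -/p in ju jv.
case: ati => [u0|v0].
  split=> //; case: (ltnP i.+1 (n - 3)) => i1; last by move: duv; case: ifP; lia.
  have e1 : lo i.+1 = lo' i.+1 by apply: agree => //; lia.
  case: (off p v =P i.+2) => // v0; case: nb; exists i.+1.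
  by rewrite -e1 (chain_shift_next c c' i1 e1 shift) -/p; split=> //; lia.
split=> //.
case: (off p u =P 0%N) => // u0; case: (posnP i) => [i0|ipos]; first by move: duv; case: ifP; lia.
case: nb; exists i.-1; have i1 : (i.-1.+1 < n - 3)%N by lia.
have e1 : lo i.-1 = lo' i.-1 by apply: agree; lia.
rewrite -e1 (chain_shift_prev c c' i1 e1) prednK // !off_next -/p.
by split; first lia; case: eqP; lia.
Qed.

(** The mirror image: now p and q have exchanged their roles. *)
Lemma before_shift_gained u v : polygon_diagonal u v ->
  before lo' u v -> ~~ before lo u v -> u = hi lo i /\ v = lo i.
Proof.
set p := lo i; rewrite (polygon_diagonal_base p) => duv /beforeP [j [j_n ju jv]] /beforeP nb.
have ji : j = i.
  by case: (j =P i) => // ji; case: nb; exists j; rewrite (agree j_n ji).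
subst j.
have un := off_lt n_gt4 p u; have vn := off_lt n_gt4 p v.
suff [ua vb] : off p u = i.+2 /\ off p v = 0%N.
  by split; apply: (@off_inj n p); rewrite ?off_id ?off_hi.
have {}ju : (0 < off p u < i.+3)%N.
  by move: ju; rewrite shift off_next -/p; case: eqP; lia.
have {}jv : off p v = 0%N \/ (i.+3 <= off p v)%N.
  by move: jv; rewrite shift off_next -/p; case: eqP; lia.
have ati : off p u = i.+2 \/ off p v = 0%N.
  case: (off p u =P i.+2) => [|u0]; first by left.
  case: (off p v =P 0%N) => [|v0]; first by right.
  by case: nb; exists i; rewrite -/p; split=> //; lia.
case: ati => [u0|v0].
  split=> //; case: (ltnP i.+1 (n - 3)) => i1; last by move: duv; case: ifP; lia.
  have e1 : lo i.+1 = lo' i.+1 by apply: agree => //; lia.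
  case: (off p v =P 0%N) => // v0; case: nb; exists i.+1.
  by rewrite (chain_shift_next c c' i1 e1 shift) -/p; split=> //; lia.
split=> //.
case: (off p u =P i.+2) => // u0; case: (posnP i) => [i0|ipos]; first by move: duv; case: ifP; lia.
case: nb; exists i.-1; have i1 : (i.-1.+1 < n - 3)%N by lia.
have e1 : lo i.-1 = lo' i.-1 by apply: agree; lia.
rewrite (chain_shift_prev c c' i1 e1) prednK // !off_next -/p.
by split; first lia; case: eqP; lia.
Qed.

Lemma before_shift_source : before lo (lo i) (hi lo i).
Proof. by apply/beforeP; exists i; rewrite off_id off_hi. Qed.

Lemma before_shift_target : before lo' (hi lo i) (lo i).
Proof.
apply/beforeP; exists i; rewrite shift !off_next off_hi off_id /=.
by split=> //; lia.
Qed.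
End Shift.

(** A chord determines its arc of given size unless it is a diameter. *)
Lemma endpoints_eq p p' s : (0 < s < n)%N ->
  [set p; p + s%:R]%SET = [set p'; p' + s%:R]%SET ->
  p = p' \/ off p p' = s /\ s.*2 = n.
Proof.
move=> sn e; have : p' \in [set p; p + s%:R]%SET by rewrite e !inE eqxx.
have : p \in [set p'; p' + s%:R]%SET by rewrite -e !inE eqxx.
rewrite !inE => /orP[/eqP->|/eqP h]; first by left.
move=> /orP[/eqP->|/eqP h']; first by left.
right; have o1 : off p p' = s by rewrite h' off_addn //; lia.
split=> //; have := off_id p; rewrite [X in off _ X]h.
rewrite h' -addrA -natrD => E.
case: (ltnP (s + s) n) => sn2; first by rewrite off_addn // in E; lia.
move: E; rewrite (_ : s + s = n + (s + s - n))%N; last lia.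
by rewrite natrD pchar_Zp ?add0r ?off_addn //; lia.
Qed.

(** Chains with the same chords away from i have the same arcs there. The only
    ambiguity is a diameter, whose two arcs are disjoint and cover everything:
    they are incompatible with a common arc one step before or one step after,
    and one of these steps is different from i. *)
Lemma chain_agree lo lo' i : chain lo -> chain lo' ->
  (forall j, (j < n - 3)%N -> j <> i ->
     [set lo j; hi lo j]%SET = [set lo' j; hi lo' j]%SET) ->
  forall j, (j < n - 3)%N -> j <> i -> lo j = lo' j.
Proof.
move=> c c' E.
have C j : (j < n - 3)%N -> j <> i ->
    lo j = lo' j \/ off (lo j) (lo' j) = j.+2 /\ j.+2.*2 = n.
  by move=> jn ji; apply: endpoints_eq (E j jn ji); lia.
move=> j j_n ji; case: (C j j_n ji) => // -[o1 o2]; exfalso.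
have hj := off_next (lo j).
case: (j.+1 =P i) => j1.
  have j0 : (j.-1.+1 < n - 3)%N by lia.
  have [||e|] := C j.-1; [lia|lia| |lia].
  have := c _ j0; have := c' _ j0; rewrite -e prednK; last lia.
  have o0 := off_id (lo j); case=> h; case=> h'.
  - by rewrite h h' off_id in o1; lia.
  - by rewrite h h' -[X in off _ X](subrK 1) (off_add1 n_gt4) off_id in o1; case: eqP o1; lia.
  - by rewrite h h' (off_sub1 n_gt4) off_id in o1; rewrite /= in o1; lia.
  - by rewrite h h' off_id in o1; lia.
have jn1 : (j.+1 < n - 3)%N by lia.
have [||e|] := C j.+1; [lia|lia| |lia].
have := c _ jn1; have := c' _ jn1; rewrite -e => h h'.
have {}h : off (lo j) (lo j.+1) = j.+2 \/ off (lo j) (lo j.+1) = j.+1.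
  by case: h => ->; rewrite ?(off_sub1 n_gt4) o1; [left|right].
have {}h' : off (lo j) (lo j.+1) = 0%N \/ off (lo j) (lo j.+1) = n.-1.
  by case: h' => ->; rewrite ?(off_sub1 n_gt4) off_id; [left|right].
lia.
Qed.

(** Between a common arc before or after i, there are two possible arcs at i. *)
Lemma chain_flip_shift lo lo' i : chain lo -> chain lo' -> (i < n - 3)%N ->
  (forall j, (j < n - 3)%N -> j <> i -> lo j = lo' j) -> lo i <> lo' i ->
  lo' i = lo i + 1 \/ lo i = lo' i + 1.
Proof.
move=> c c' i_n agree ne; case: (posnP i) => [i0|ipos].
  have i1 : (i.+1 < n - 3)%N by lia.
  have e : lo i.+1 = lo' i.+1 by apply: agree; lia.
  have := c _ i1; have := c' _ i1; rewrite -e.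
  case=> h [] h'; [by case: ne; rewrite -h' -h| | |].
  - by right; rewrite -h h' subrK.
  - by left; rewrite -h' h subrK.
  - by case: ne; apply: (addIr (-1)); rewrite -h' -h.
have i1 : (i.-1.+1 < n - 3)%N by lia.
have e : lo i.-1 = lo' i.-1 by apply: agree; lia.
have := c _ i1; have := c' _ i1; rewrite -e prednK //.
case=> h [] h'; rewrite h h' ?subrK; [by case: ne; rewrite h h'|by left|by right|].
by case: ne; rewrite h h'.
Qed.
End Chains.

(** * The chords of a coloured triangle-free triangulation form a chain *)

Section Triangulations.
Local Open Scope ring_scope.
Variable n : nat.
Hypothesis n_gt4 : (4 < n)%N.
Implicit Types (p q r u v x y z w : 'Z_n) (A : {set {set 'Z_n}}) (D E : {set 'Z_n}).
Implicit Type T : coloring n.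

(** The definition of crossing reads the vertices from 0; any other base point p
    serves as well, by rotating the four interleaved endpoints. *)
Lemma crossing_cyclic p D E : crossing D E || crossing E D ->
  exists x y z w, [/\ (off p x < off p y)%N, (off p y < off p z)%N,
    (off p z < off p w)%N & (D = [set x; z] /\ E = [set y; w])%SET \/
                            (D = [set y; w] /\ E = [set x; z])%SET].
Proof.
wlog cDE : D E / crossing D E.
  move=> WL /orP[] c; first by apply: WL => //; rewrite c.
  have [|x [y [z [w [xy yz zw H]]]]] := WL E D c; first by rewrite c.
  by exists x, y, z, w; split=> //; case: H => -[-> ->]; [right|left].
move=> _; case/existsP: cDE => a /existsP[b /existsP[c /existsP[d]]].
case/and5P=> ab bc cd /eqP-> /eqP->.
have up y1 y2 : (y1 < y2)%N -> (p <= y1)%N || (y2 < p)%N -> (off p y1 < off p y2)%N.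
  have := Zn_lt n_gt4 y1; have := Zn_lt n_gt4 y2; have := Zn_lt n_gt4 p.
  by rewrite !(off_val n_gt4); case: (leqP p y1); case: (leqP p y2); lia.
have wrap y1 y2 : (y1 < p)%N -> (p <= y2)%N -> (off p y2 < off p y1)%N.
  have := Zn_lt n_gt4 y1; have := Zn_lt n_gt4 y2; have := Zn_lt n_gt4 p.
  by rewrite !(off_val n_gt4); case: (leqP p y1); case: (leqP p y2); lia.
case: (leqP p a) => pa.
  by exists a, b, c, d; split; [apply: up; lia..|left].
case: (leqP p b) => pb.
  exists b, c, d, a; split; [apply: up; lia|apply: up; lia|apply: wrap; lia|].
  by right; rewrite (finset.setUC [set c]%SET).
case: (leqP p c) => pc.
  exists c, d, a, b; split; [apply: up; lia|apply: wrap; lia|apply: up; lia|].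
  by left; rewrite (finset.setUC [set c]%SET) (finset.setUC [set d]%SET).
case: (leqP p d) => pd.
  exists d, a, b, c; split; [apply: wrap; lia|apply: up; lia|apply: up; lia|].
  by right; rewrite (finset.setUC [set d]%SET).
by exists a, b, c, d; split; [apply: up; lia..|left].
Qed.

Lemma crossing_of_off p x y z w :
  (off p x < off p y)%N -> (off p y < off p z)%N -> (off p z < off p w)%N ->
  crossing [set x; z]%SET [set y; w]%SET || crossing [set y; w]%SET [set x; z]%SET.
Proof.
have C (a b c d : 'Z_n) : (a < b)%N -> (b < c)%N -> (c < d)%N ->
    crossing [set a; c]%SET [set b; d]%SET.
  move=> ab bc cd; apply/existsP; exists a; apply/existsP; exists b.
  by apply/existsP; exists c; apply/existsP; exists d; rewrite ab bc cd !eqxx.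
have xn := Zn_lt n_gt4 x; have yn := Zn_lt n_gt4 y; have zn := Zn_lt n_gt4 z.
have wn := Zn_lt n_gt4 w; have pn := Zn_lt n_gt4 p.
rewrite !(off_val n_gt4) => xy yz zw.
have : [\/ [/\ x < y, y < z & z < w]%N, [/\ y < z, z < w & w < x]%N,
           [/\ z < w, w < x & x < y]%N | [/\ w < x, x < y & y < z]%N].
  move: xy yz zw; case: (leqP p x); case: (leqP p y); case: (leqP p z);
    case: (leqP p w) => *; try (exfalso; lia);
    first [by constructor 1; split; lia | by constructor 2; split; lia
          |by constructor 3; split; lia | by constructor 4; split; lia].
case=> -[h1 h2 h3].
- by rewrite C.
- by rewrite (finset.setUC [set x]%SET) (C y z w x) ?orbT.
- by rewrite (finset.setUC [set x]%SET) (finset.setUC [set y]%SET) (C z w x y).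
- by rewrite (finset.setUC [set y]%SET) (C w x y z) ?orbT.
Qed.

Lemma off_sym p q : p <> q -> (off q p = n - off p q)%N.
Proof.
move=> pq; rewrite (off_base n_gt4 p) off_id leqn0; case: eqP => // e.
by case: pq; apply: (@off_inj n p); rewrite off_id e.
Qed.

Lemma polygon_diagonal_sym p q : polygon_diagonal p q = polygon_diagonal q p.
Proof.
by rewrite /polygon_diagonal eq_sym finset.setUC.
Qed.

Lemma set2_inj x y z w : [set x; y]%SET = [set z; w]%SET ->
  x = z /\ y = w \/ x = w /\ y = z.
Proof.
move=> e; have : x \in [set z; w]%SET by rewrite -e !inE eqxx.
have : y \in [set z; w]%SET by rewrite -e !inE eqxx orbT.
have : z \in [set x; y]%SET by rewrite e !inE eqxx.
have : w \in [set x; y]%SET by rewrite e !inE eqxx orbT.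
rewrite !inE.
by move=> /orP[]/eqP h1 /orP[]/eqP h2 /orP[]/eqP h3 /orP[]/eqP h4;
  subst; (by left) || (by right).
Qed.

Lemma is_diagonal2 p q : is_diagonal [set p; q]%SET = polygon_diagonal p q.
Proof.
apply/existsP/idP => [[i /existsP[j /andP[ij /eqP/set2_inj[][-> ->]]]]//|pq].
  by rewrite polygon_diagonal_sym.
by exists p; apply/existsP; exists q; rewrite pq eqxx.
Qed.

Lemma is_diagonalN D : is_diagonal D -> ~~ external D.
Proof. by case/existsP=> i /existsP[j /andP[/andP[_ ne] /eqP->]]. Qed.

Lemma external_off p q : p <> q -> external [set p; q]%SET ->
  off p q = 1%N \/ off p q = n.-1.
Proof.
move=> pq ex; have : ~~ polygon_diagonal p q by rewrite /polygon_diagonal ex andbF.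
rewrite (polygon_diagonal_off n_gt4).
have : off p q <> 0%N by move=> e; apply/pq/(@off_inj n p); rewrite off_id e.
by have := off_lt n_gt4 p q; lia.
Qed.

Lemma noncrossing_off A p x y z w : noncrossing A ->
  ([set x; z] \in A)%SET -> ([set y; w] \in A)%SET ->
  (off p x < off p y)%N -> (off p y < off p z)%N -> (off p z < off p w)%N -> False.
Proof.
case/andP=> _ /forall_inP nc xz yw h1 h2 h3; have := crossing_of_off h1 h2 h3.
by rewrite (negbTE (forall_inP (nc _ xz) _ yw)) (negbTE (forall_inP (nc _ yw) _ xz)).
Qed.

Definition joined A x y := external [set x; y]%SET || ([set x; y]%SET \in A).

(** Every chord {p, q} has a triangle on the side of the vertices from q to p. Its
    apex r is the neighbour of q, chord or edge, that is farthest from q before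
    p: a chord crossing {r, p} would cross {p, q} or {q, r}, or would start at q
    and end beyond r, so {r, p} is an edge or belongs to A by maximality. *)
Lemma far_vertex A p q : triangulation A -> [set p; q]%SET \in A ->
  exists r, [/\ (0 < off q r < off q p)%N, joined A q r & joined A r p].
Proof.
case/maxsetP=> ncA maxA pqA.
have diagA D : D \in A -> is_diagonal D.
  by case/andP: ncA => /forall_inP dA _; apply: dA.
have := diagA _ pqA; rewrite is_diagonal2 polygon_diagonal_sym (polygon_diagonal_off n_gt4).
move=> /andP[qp1 qp2].
have off1 x : off x (x + 1) = 1%N.
  by rewrite (off_add1 n_gt4) off_id; case: eqP; lia.
have joined1 x : joined A x (x + 1).
  by rewrite /joined; apply/orP; left; apply/existsP; exists x.
pose P r := (0 < off q r < off q p)%N && joined A q r.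
have P1 : P (q + 1) by rewrite /P off1 joined1 qp1.
case: (arg_maxnP (off q) P1) => r /andP[/andP[r0 rp] qr] rmax.
exists r; rewrite r0 rp qr; split=> //; apply: contraT; rewrite negb_or => /andP[nex rpA].
have rnp : r != p by apply/eqP => e; rewrite e in rp; lia.
have neq0 x : off q x = 0%N -> x = q by move=> e; apply: (@off_inj n q); rewrite off_id e.
have qpA : [set q; p]%SET \in A by rewrite finset.setUC.
have noX E : E \in A -> ~ (crossing [set r; p]%SET E || crossing E [set r; p]%SET).
  move=> EA /(crossing_cyclic q)[x [y [z [w [xy yz zw]]]]].
  case=> -[/set2_inj[][ex ez] eE]; rewrite eE in EA; subst.
  - by apply: (noncrossing_off ncA qpA EA _ yz zw); rewrite off_id (leq_ltn_trans _ xy).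
  - by have := ltn_trans (ltn_trans xy yz) rp; rewrite ltnn.
  - case: (posnP (off q x)) => [/neq0 e|x0].
      subst x; have := rmax z; rewrite /P /joined EA orbT andbT zw (leq_ltn_trans _ yz) //.
      by move=> /(_ isT) /(leq_trans yz); rewrite ltnn.
    have nqr : q <> y by move=> e; rewrite -e off_id in r0.
    case/orP: qr => [/external_off[]//|qyA].
    + by move=> e; rewrite e ltnS leqNgt x0 in xy.
    + by move=> e; rewrite e in rp; move: rp (off_lt n_gt4 q w); clear -n_gt4; lia.
    + by apply: (noncrossing_off ncA qyA EA _ xy yz); rewrite off_id.
  - by have := ltn_trans (ltn_trans yz zw) rp; rewrite ltnn.
have ncB : noncrossing ([set r; p] |: A)%SET.
  apply/andP; split; apply/forall_inP => D /setU1P[->|DA].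
  - by rewrite is_diagonal2 /polygon_diagonal rnp nex.
  - exact: diagA.
  - apply/forall_inP => E /setU1P[->|EA]; apply/negP => c.
      have := c; case/existsP => a /existsP[b /existsP[d /existsP[e]]].
      case/and5P => ab bd de /eqP e1 /eqP e2.
      by move: e2; rewrite e1 => /set2_inj[][]*; subst; move: ab bd de; clear; lia.
    by apply: (noX E EA); rewrite c.
  - apply/forall_inP => E /setU1P[->|EA]; apply/negP => c.
      by apply: (noX D DA); rewrite c orbT.
    by case/andP: ncA => _ /forall_inP/(_ D DA)/forall_inP/(_ E EA); rewrite c.
by rewrite -(maxA _ ncB (subsetUr _ _)) setU11 in rpA.
Qed.

Lemma sides3 p q r : p <> q -> q <> r -> p <> r ->
  (sides [set p; q; r] = [set [set p; q]; [set q; r]; [set p; r]])%SET.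
Proof.
move=> /eqP pq /eqP qr /eqP pr; apply/setP => D; rewrite !inE; apply/andP/idP.
  case=> /subsetP s /cards2P[x [y [xy eD]]]; subst D.
  have := s x; have := s y; rewrite !inE !eqxx orbT => /(_ isT) h /(_ isT).
  by case/orP: h => [/orP[]|] /eqP ?; subst y => /orP[/orP[]|] /eqP ?; subst x;
    rewrite ?eqxx in xy => //; rewrite ?eqxx ?orbT // finset.setUC ?eqxx ?orbT.
case/orP=> [/orP[]|] /eqP ->; rewrite cards2 ?pq ?qr ?pr; split=> //;
  by apply/subsetP => x; rewrite !inE => /orP[] /eqP ->; rewrite eqxx ?orbT.
Qed.

Lemma chords_diagonal T D : CTFT T -> D \in chords T -> is_diagonal D.
Proof.
by case/and3P => /maxsetP[/andP[/forall_inP dA _] _] _ _; apply: dA.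
Qed.

(** The triangle behind {p, q} has an external side, since T is triangle-free,
    and only one when at least two vertices lie behind {p, q}. Its other internal
    side is a neighbouring diagonal, whose label the colouring controls. *)
Lemma next_chord T p q : CTFT T -> [set p; q]%SET \in chords T -> (2 < off q p)%N ->
  exists D, [/\ D \in chords T, consecutive (index [set p; q]%SET T) (index D T)
    & D = [set p - 1; q]%SET \/ D = [set p; q + 1]%SET].
Proof.
move=> cT pqA qp2; have diag D := chords_diagonal cT (D := D).
have := diag _ pqA; rewrite is_diagonal2 polygon_diagonal_sym (polygon_diagonal_off n_gt4).
move=> /andP[_ qp3].
case/and3P: cT => triT /forall_inP freeT /and3P[uT _ /forall_inP colT].
have [r [/andP[r0 rp] qr rp']] := far_vertex triT pqA.
have npq : p <> q by move=> e; rewrite e off_id in qp2.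
have nqr : q <> r by move=> e; rewrite e off_id in r0.
have npr : p <> r by move=> e; rewrite e ltnn in rp.
set A := chords T in pqA qr rp' diag freeT colT triT *; clearbody A.
have exN D : external D -> D \notin A.
  by move=> ex; apply/negP => /diag/is_diagonalN; rewrite ex.
have pr' : joined A p r by rewrite /joined finset.setUC.
have tri : [set p; q; r]%SET \in triangles A.
  rewrite !inE; apply/andP; split.
    rewrite finset.setUC cardsU1 cards2 !inE (introF eqP npq).
    by rewrite !(eq_sym r) (introF eqP npr) (introF eqP nqr).
  apply/forall_inP => D; rewrite sides3 // => /setUP[/set2P[]|/set1P] ->.
  - by rewrite pqA orbT.
  - exact: qr.
  - exact: pr'.
have freeB := freeT _ tri.
have colB : #|sides [set p; q; r]%SET :&: A| = 2%N ->
    {in (sides [set p; q; r] :&: A)%SET &, forall D E : {set 'Z_n}, D != E ->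
      consecutive (index D T) (index E T)}.
  move=> /eqP c D E DB EB DE.
  have /implyP/(_ c)/forall_inP/(_ D DB)/forall_inP/(_ E EB)/implyP := colT _ tri.
  exact.
rewrite sides3 // in freeB colB.
have d1 : [set p; q]%SET != [set q; r]%SET :> {set 'Z_n}.
  by apply/eqP => /set2_inj[][]*; subst.
have d2 : [set p; q]%SET != [set p; r]%SET :> {set 'Z_n}.
  by apply/eqP => /set2_inj[][]*; subst.
have d3 : [set q; r]%SET != [set p; r]%SET :> {set 'Z_n}.
  by apply/eqP => /set2_inj[][]*; subst.
set B := (_ :&: A)%SET in freeB colB.
have pqB : [set p; q]%SET \in B by rewrite !inE eqxx pqA.
case/orP: qr => [ex|qrA].
  have o1 : off q r = 1%N.
    case: (external_off nqr ex) => // e; move: rp (off_lt n_gt4 q p).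
    by rewrite e; clear; lia.
  have er : r = q + 1.
    by apply: (@off_inj n q); rewrite (off_add1 n_gt4) o1 off_id; case: eqP; clear -n_gt4; lia.
  have prA : [set p; r]%SET \in A.
    rewrite finset.setUC; case/orP: rp' => // /external_off[e|e|e]; first by rewrite e in npr.
      by move: e qp2; rewrite (off_base n_gt4 q) o1; case: leqP; clear; lia.
    by move: e qp2 qp3; rewrite (off_base n_gt4 q) o1; case: leqP; clear; lia.
  exists [set p; r]%SET; split=> //; last by right; rewrite er.
  have eB : B = [set [set p; q]; [set p; r]]%SET.
    apply/setP => D; rewrite !inE; apply/andP/orP; last by case=> /eqP->; rewrite eqxx ?orbT.
    case=> /orP[/orP[/eqP->|/eqP->]|/eqP->]; rewrite ?eqxx; [by left| |by right].
    by rewrite (negbTE (exN _ ex)).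
  apply: colB => //; first by rewrite eB cards2 d2.
  by rewrite eB !inE eqxx orbT.
case/orP: rp' => [ex|rpA]; last first.
  move: freeB; rewrite (_ : B = [set [set p; q]; [set q; r]; [set p; r]]%SET).
    by rewrite -finset.setUA cardsU1 cards2 d3 !inE negb_or d1 d2.
  apply/setIidPl/subsetP => D; rewrite !inE.
  by case/orP=> [/orP[]|]/eqP->; rewrite 1?(finset.setUC [set p]%SET [set r]%SET) -1?/A.
have nrp : r <> p by move=> e; rewrite e in npr.
have o1 : off r p = 1%N.
  case: (external_off nrp ex) => //; rewrite (off_base n_gt4 q) ltnW //.
  by move: qp3 r0 rp n_gt4; clear; lia.
have er : r = p - 1.
  have -> : p = r + 1 by apply: (@off_inj n r); rewrite (off_add1 n_gt4) o1 off_id; case: eqP; clear -n_gt4; lia.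
  by rewrite addrK.
exists [set q; r]%SET; split=> //; last by left; rewrite er finset.setUC.
have eB : B = [set [set p; q]; [set q; r]]%SET.
  apply/setP => D; rewrite !inE; apply/andP/orP.
    case=> /orP[/orP[/eqP->|/eqP->]|/eqP->]; rewrite ?eqxx; [by left|by right|].
    by rewrite finset.setUC (negbTE (exN _ ex)).
  by case=> /eqP->; rewrite eqxx ?orbT.
apply: colB => //; first by rewrite eB cards2 d1.
by rewrite eB !inE eqxx orbT.
Qed.

(** The left end a - k of the chord [a - k, a + m] labelled j. *)
Definition lo T (j : nat) : 'Z_n := base T - (chord_ends T j).1%:R.

Lemma mem_chords T j : (j < n - 3)%N -> nth finset.set0 T j \in chords T.
Proof. by move=> jn; rewrite inE mem_nth // size_tuple. Qed.

(** By [next_chord] an extension of chord j has label j + 1 or j - 1, and chord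
    j - 1 lies on the other side of chord j. *)
Lemma chord_endsP T : CTFT T -> forall j, (j < n - 3)%N ->
  ((chord_ends T j).1 + (chord_ends T j).2 = j.+2)%N /\
  nth finset.set0 T j = [set lo T j; base T + (chord_ends T j).2%:R]%SET.
Proof.
move=> cT; elim/ltn_ind => -[_ _|j IH jn].
  split=> //; rewrite /lo /= subr0.
  case/and3P: cT => _ _ /and3P[_ sh _]; rewrite /base.
  case: pickP => [a /eqP->//|/= no]; exfalso.
  case/existsP: sh => i /eqP e; have := no (i - 1); rewrite e.
  by rewrite (_ : i - 1 + 2%:R = i + 1) ?eqxx // -addrA; congr (_ + _); rewrite mulr2n addKr.
have j_n : (j < n - 3)%N by lia.
have [] := IH j _ j_n => //; rewrite /lo /=.
case ce : (chord_ends T j) => [k m] /= km e.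
set p := base T - k%:R in e; set q := base T + m%:R in e.
have eq : q = p + j.+2%:R by rewrite -km natrD addrA subrK.
have opq : off p q = j.+2 by rewrite eq off_addn //; lia.
have npq : p <> q by move=> h; rewrite h off_id in opq.
have pqA := mem_chords T j_n; rewrite e in pqA.
have uT : uniq T by case/and3P: cT => _ _ /and3P[].
have iD : index [set p; q]%SET T = j by rewrite -e index_uniq ?size_tuple.
have oqp : (off q p = n - j.+2)%N by rewrite off_sym // opq.
have qp2 : (2 < off q p)%N by rewrite oqp; move: jn; clear; lia.
have [D [DA Dj De]] := next_chord cT pqA qp2.
have nD : nth finset.set0 T (index D T) = D.
  by move: DA; rewrite inE => DA; rewrite nth_index.
rewrite iD in Dj; case/orP: Dj => /eqP Dj.
  rewrite Dj in nD; rewrite /goes_left nD; case: eqP => h /=.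
    split; first lia.
    by rewrite h -natr1 opprD addrA.
  split; first lia.
  case: De => De; first by case: h.
  by rewrite De -natr1 addrA.
exfalso; case ce' : (chord_ends T (index D T)) => [k' m'].
have [||_ e'] := IH (index D T); [lia|lia|].
rewrite nD /lo ce' /= in e'; move: ce; rewrite Dj /= ce'.
have p1 := @add1_neq n n_gt4; have p2 := @add1_sub1_neq n n_gt4.
have oq1 : p + 1 <> q.
  by move=> h; rewrite -h (off_add1 n_gt4) off_id in opq; case: eqP opq; lia.
case: ifP => _ [ek em].
  have h1 : base T - k'%:R = p + 1 by rewrite /p -ek -natr1 opprD addrA subrK.
  rewrite h1 em -/q in e'; case: De; rewrite e' => /set2_inj[][].
  - by move/p2.
  - by move/oq1.
  - by move/p1.
  - by move/addIr/npq.
have h1 : base T + m'%:R = q - 1 by rewrite /q -em -natr1 addrA addrK.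
rewrite h1 ek -/p in e'; case: De; rewrite e' => /set2_inj[][].
- by move/(congr1 (fun x => x + 1)); rewrite subrK => /p1.
- by move/npq.
- by move=> _ /esym/p2.
- by move=> _ /(congr1 (fun x => x + 1)); rewrite subrK => /esym/oq1.
Qed.

Lemma lo_chain T : chain (lo T).
Proof.
move=> j jn; rewrite /lo /=; case: (chord_ends T j) => k m; case: ifP => _ /=; last by left.
by right; rewrite -natr1 opprD addrA.
Qed.

Lemma nth_chord T j : CTFT T -> (j < n - 3)%N ->
  nth finset.set0 T j = [set lo T j; hi (lo T) j]%SET.
Proof.
move=> cT jn; have [km ->] := chord_endsP cT jn.
by rewrite /hi -km natrD addrA /lo subrK.
Qed.
End Triangulations.

(** * The arc permutations of a chain *)

Section ArcPermutations.
Local Open Scope ring_scope.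
Variable n : nat.
Hypothesis n_gt4 : (4 < n)%N.
Implicit Types (p q u v x : 'Z_n) (pi tau : {perm 'Z_n}) (k s : nat).

Lemma arc_interval p k : (k < n)%N -> interval_Z (half_arc p k.+1).
Proof.
move=> kn; apply/existsP; exists p; apply/existsP; exists k%:R; apply/eqP/setP => x.
rewrite in_half_arc; apply/idP/imsetP.
  move=> h; exists (x - p); last by rewrite addrC subrK.
  by rewrite inE val_natZ.
by case=> l; rewrite inE val_natZ // => lk ->; rewrite /off addrAC subrr add0r ltnS.
Qed.

Lemma interval_arc (A : {set 'Z_n}) : interval_Z A ->
  exists p s, (0 < s)%N /\ A = half_arc p s.
Proof.
case/existsP=> p /existsP[k /eqP->]; exists p, (k : nat).+1; split=> //.
apply/setP => x; rewrite in_half_arc; apply/imsetP/idP.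
  by case=> l; rewrite inE => lk ->; rewrite /off addrAC subrr add0r ltnS.
by move=> h; exists (x - p); rewrite ?inE // addrC subrK.
Qed.

Lemma in_prefix pi (P : pred 'Z_n) u :
  (u \in [set pi p | p : 'Z_n & P p]%SET) = P (pi^-1%g u).
Proof.
apply/imsetP/idP => [[p pk ->]|h]; first by rewrite permK; rewrite inE in pk.
by exists (pi^-1%g u); rewrite ?inE // permKV.
Qed.

Lemma arc_permsP pi : reflect
  (forall k, (k < n)%N -> exists p s, (0 < s)%N /\
     forall u, ((pi^-1)%g u <= k)%N = (off p u < s)%N)
  (pi \in arc_perms n).
Proof.
rewrite inE; apply: (iffP forallP) => [h k kn|h k].
  have [p [s [s0 e]]] := interval_arc (h k%:R); exists p, s; split=> // u.
  by rewrite -in_half_arc -e in_prefix val_natZ.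
have [p [s [s0 e]]] := h _ (Zn_lt n_gt4 k).
rewrite (_ : imset _ _ = half_arc p (minn s n).-1.+1).
  by apply: arc_interval; move: n_gt4 s0; clear; lia.
apply/setP => u; rewrite in_prefix e in_half_arc; have := off_lt n_gt4 p u.
by move: n_gt4 s0; clear; lia.
Qed.

Lemma bigcup_has (w : seq {set 'Z_n}) u :
  (u \in \bigcup_(A <- w) A)%SET = has (fun A : {set 'Z_n} => u \in A) w.
Proof. by elim: w => [|A w IH]; rewrite ?big_nil ?big_cons ?inE // IH. Qed.

Lemma in_set_perm pi u k : (k < n)%N ->
  (u \in [set pi k%:R]%SET) = (pi^-1%g u == k :> nat).
Proof.
move=> kn; rewrite inE; apply/eqP/eqP => [->|e]; first by rewrite permK val_natZ.
by rewrite -e natr_Zp permKV.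
Qed.

Lemma in_pair_perm pi u k l : (k < n)%N -> (l < n)%N ->
  (u \in [set pi k%:R; pi l%:R]%SET) =
  ((pi^-1%g u == k :> nat) || (pi^-1%g u == l :> nat)).
Proof. by move=> kn ln; rewrite in_setU !in_set_perm. Qed.

(** The first k blocks hold the first k + 1 letters, because the first block has
    two of them. *)
Lemma take_blocks pi u k : (0 < k <= n - 3)%N ->
  has (fun A : {set 'Z_n} => u \in A) (take k (blocks pi)) = (pi^-1%g u <= k)%N.
Proof.
case: k => // k /andP[_ kn]; rewrite /blocks /= -cats1 takel_cat; last first.
  by rewrite size_map size_iota; lia.
rewrite -map_take take_iota has_map.
have -> : ([set pi 0; pi 1] = [set pi 0%:R; pi 1%:R])%SET by [].
rewrite in_pair_perm; try lia.
have -> : has (preim (fun p : nat => [set pi p%:R]%SET) (fun A : {set 'Z_n} => u \in A))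
    (iota 2 (minn k (n - 4))) = ((2 <= pi^-1%g u) && (pi^-1%g u <= k.+1))%N.
  apply/hasP/andP => [[p]|[h1 h2]].
    rewrite mem_iota => pk; rewrite /= in_set_perm; last lia.
    by move=> /eqP ->; lia.
  exists (pi^-1%g u : nat); first by rewrite mem_iota; lia.
  by rewrite /= in_set_perm ?eqxx // Zn_lt.
move: (nat_of_ord _) => a; clear; lia.
Qed.

Lemma prefix_eq_blocks pi tau :
  (forall u k, (0 < k <= n - 3)%N -> (pi^-1%g u <= k)%N = (tau^-1%g u <= k)%N) ->
  blocks pi = blocks tau.
Proof.
move=> h; have pn u := Zn_lt n_gt4 (pi^-1%g u); have tn u := Zn_lt n_gt4 (tau^-1%g u).
congr (_ :: rcons _ _).
- have e1 : ([set pi 0; pi 1] = [set pi 0%:R; pi 1%:R])%SET by [].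
  have e2 : ([set tau 0; tau 1] = [set tau 0%:R; tau 1%:R])%SET by [].
  rewrite e1 e2; apply/setP => u; rewrite !in_pair_perm; try lia.
  by have := h u 1%N; have := pn u; have := tn u; lia.
- apply/eq_in_map => p; rewrite mem_iota => pk; apply/setP => u.
  rewrite !in_set_perm; try lia.
  by have := h u p; have := h u p.-1; lia.
- apply/setP => u; rewrite !in_pair_perm; try lia.
  by have := h u (n - 3)%N; have := pn u; have := tn u; lia.
Qed.

Lemma blocks_prefix pi tau : blocks pi = blocks tau ->
  forall u k, (0 < k <= n - 3)%N -> (pi^-1%g u <= k)%N = (tau^-1%g u <= k)%N.
Proof. by move=> e u k kn; rewrite -!take_blocks // e. Qed.

(** An arc with one more letter that is still an arc has grown at an end: a gap on
    each side of u would separate it from the starting point p. *)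
Lemma arc_extend p s p' s' u : (0 < s)%N -> (s <= off p u)%N ->
  (forall x, (off p' x < s')%N = (off p x < s)%N || (x == u)) ->
  off p u = s \/ off p u = n.-1.
Proof.
move=> s0 su h; have un := off_lt n_gt4 p u.
case: (off p u =P s) => [|n1]; first by left.
case: (off p u =P n.-1) => [|n2]; first by right.
exfalso; have p'n := off_lt n_gt4 p p'.
have K k : (k < n)%N -> ((if off p p' <= k then k - off p p'
    else k + n - off p p') < s')%N = (k < s)%N || (k == off p u).
  move=> kn; have := h (p + k%:R); rewrite (off_base n_gt4 p) !off_addn //.
  suff -> : (p + k%:R == u) = (k == off p u) by [].
  by apply/eqP/eqP => [<-|->]; rewrite ?off_addn // offK.
have n0 : (0 < n)%N by move: n_gt4; clear; lia.
case: (posnP (off p p')) => b0.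
  have := K _ (leq_ltn_trans su un); have := K _ un.
  rewrite b0 /= !subn0 eqxx orbT => /(leq_trans _) h1.
  rewrite ltnn eq_sym (introF eqP n1) => /negbT; rewrite -leqNgt => h2.
  by have := leq_trans h2 su; rewrite leqNgt h1.
have := K 0%N n0; rewrite s0 (leqNgt (off p p')) b0 /= add0n => h1.
have n1n : (n.-1 < n)%N by rewrite prednK.
have := K _ n1n; rewrite -(ltnS (off p p')) (prednK n0) p'n [in RHS]eq_sym (introF eqP n2).
have -> : (n <= s)%N = false by rewrite leqNgt (leq_ltn_trans su un).
by move: h1 b0 p'n; clear; lia.
Qed.

Lemma val_add1 p : (p.+1 < n)%N -> (p + 1 : 'Z_n) = p.+1 :> nat.
Proof.
by move=> h; rewrite (_ : p + 1 = p.+1%:R) ?val_natZ // -natr1 natr_Zp.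
Qed.

(** Exchanging the letters at positions p and p + 1 with 0 < p < n - 2 would give
    arcs before, and in both orders after adding one of the two letters. So these
    letters are the two outer neighbours of an arc with at least three letters in
    its complement, and such neighbours are not adjacent. *)
Lemma Kswitch_blocks pi tau : Kswitch pi tau -> blocks pi = blocks tau.
Proof.
case/and3P=> /arc_permsP api /arc_permsP atau /existsP[p /existsP[j /and3P[pn /eqP pj /eqP et]]].
have vp1 := val_add1 pn.
have tauV u : (tau^-1)%g u = tperm p (p + 1) ((pi^-1)%g u).
  by rewrite et invMg tpermV permM.
have tauVE u : nat_of_ord ((tau^-1)%g u) =
    if pi^-1%g u == p :> nat then p.+1 else if pi^-1%g u == p.+1 :> nat then p : nat
    else pi^-1%g u :> nat.
  rewrite tauV; case: tpermP => [->|->|n1 n2]; rewrite ?eqxx ?vp1 //.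
    by rewrite eqxx (gtn_eqF (ltnSn p)).
  case: eqP => [/val_inj/n1//|_]; case: eqP => // e; case: n2.
  by apply: val_inj; rewrite [RHS]vp1.
have other u k : k <> p -> (pi^-1%g u <= k)%N = (tau^-1%g u <= k)%N.
  by move=> kp; rewrite tauVE; case: (_ =P _ :> nat) => ?; last case: (_ =P _ :> nat) => ?;
    move: kp; lia.
case: (boolP ((0 < p) && (p <= n - 3))%N) => [/andP[p0 pn3]|np]; last first.
  by apply: prefix_eq_blocks => u k kn; apply: other => e; move: np; rewrite -e kn.
exfalso; have pn' := Zn_lt n_gt4 p.
have [|a [s [s0 es]]] := api p.-1; first lia.
have [b [s1 [_ es1]]] := api p pn'; have [c [s2 [_ es2]]] := atau p pn'.
have oP k : (k < n)%N -> (off a (pi k%:R) < s)%N = (k < p)%N.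
  by move=> kn; rewrite -es permK val_natZ //; lia.
have inE' u k : (k < n)%N -> (u == pi k%:R) = (pi^-1%g u == k :> nat).
  by move=> kn; rewrite -in_set_perm // inE.
have h1 : off a (pi p%:R) = s \/ off a (pi p%:R) = n.-1.
  apply: (arc_extend (p' := b) (s' := s1)) => //; first by have := oP _ pn'; lia.
  by move=> x; rewrite -es1 -es inE' //; lia.
have h2 : off a (pi p.+1%:R) = s \/ off a (pi p.+1%:R) = n.-1.
  apply: (arc_extend (p' := c) (s' := s2)) => //; first by have := oP _ pn; lia.
  by move=> x; rewrite -es2 -es inE' // tauVE; do 2 (case: eqP => ?); lia.
have ne k l : (k < n)%N -> (l < n)%N -> k <> l -> off a (pi k%:R) <> off a (pi l%:R).
  move=> kn ln kl /off_inj /perm_inj e; apply: kl.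
  by rewrite -(val_natZ n_gt4 kn) -(val_natZ n_gt4 ln) e.
have p2n : (p.+2 < n)%N by lia.
have n01 := ne _ _ pn' pn; have n02 := ne _ _ pn' p2n; have n12 := ne _ _ pn p2n.
have o2 := oP _ p2n; have o2n := off_lt n_gt4 a (pi p.+2%:R).
have o1n := off_lt n_gt4 a (pi p.+1%:R); have o0n := off_lt n_gt4 a (pi p%:R).
have adj : off a (pi p.+1%:R) = off a (pi p%:R) + 1 :> nat \/
    off a (pi p%:R) = off a (pi p.+1%:R) + 1 :> nat \/ off a (pi p%:R) = 0%N \/
    off a (pi p.+1%:R) = 0%N.
  have e1 : p + 1 = p.+1%:R by rewrite -natr1 natr_Zp.
  move: pj; rewrite e1 -{1}(natr_Zp p) => /set2_inj[][-> ->].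
    by rewrite (off_add1 n_gt4); case: eqP; lia.
  by rewrite (off_add1 n_gt4); case: eqP; lia.
by move: h1 h2 n01 n02 n12 o2 o2n o1n o0n adj s0 pn; clear; lia.
Qed.

Section Reading.
Variable lo : nat -> 'Z_n.
Hypothesis c : chain lo.

(** The left end of the arc of the first s letters: this arc has s elements and is
    arc s - 2 of the chain. The cut-offs extend the chain below by the first letter
    alone, and above by two letters added on the right. *)
Definition left_end s := lo (minn (s - 2) (n - 4))%N.

Lemma left_end_step s : left_end s.+1 = left_end s \/ left_end s.+1 = left_end s - 1.
Proof.
rewrite /left_end; case: (ltnP s 2) => s2.
  by left; congr lo; lia.
case: (ltnP (s - 2) (n - 4)) => h; last by left; congr lo; lia.
have -> : (minn (s.+1 - 2) (n - 4) = (s - 2).+1)%N by lia.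
by apply: (@c (s - 2)%N); lia.
Qed.

(** The letter by which the arc with s + 1 elements exceeds the one with s. *)
Definition read s : 'Z_n :=
  if left_end s.+1 == left_end s then left_end s + s%:R else left_end s - 1.

Lemma read_arc s x : (0 < s < n)%N ->
  (off (left_end s.+1) x < s.+1)%N = (off (left_end s) x < s)%N || (x == read s).
Proof.
move=> sn; rewrite /read; have xn := off_lt n_gt4 (left_end s) x.
have E y k : (k < n)%N -> (x == y + k%:R) = (off y x == k).
  by move=> kn; apply/eqP/eqP => [->|<-]; rewrite ?off_addn ?offK.
case: (left_end s.+1 =P left_end s) => [->|ne].
  by rewrite E; lia.
case: (left_end_step s) => [//|e].
have := off_next n_gt4 (left_end s - 1) x; rewrite subrK -e => h.
rewrite -[X in x == X]addr0 (E _ 0%N); last lia.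
by rewrite h; have := off_lt n_gt4 (left_end s.+1) x; case: eqP; lia.
Qed.

Lemma read_notin s : (0 < s < n)%N -> (s <= off (left_end s) (read s))%N.
Proof.
move=> sn; rewrite /read; case: eqP => _; first by rewrite off_addn //; lia.
by rewrite (off_sub1 n_gt4) off_id /=; lia.
Qed.

Lemma read0 : read 0 = left_end 1.
Proof. by rewrite /read addr0 /left_end /= eqxx. Qed.

Lemma read_in s k : (s < k <= n)%N -> (off (left_end k) (read s) < k)%N.
Proof.
elim: k => // k IH /andP[]; rewrite ltnS leq_eqVlt => /orP[/eqP->|sk] kn.
  by case: (posnP k) => [->|k0]; rewrite ?read0 ?off_id // read_arc ?eqxx ?orbT // k0.
by rewrite read_arc ?IH ?sk //; lia.
Qed.

Lemma read_inj : injective (fun p : 'Z_n => read p).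
Proof.
have W s k : (s < k < n)%N -> read s <> read k.
  move=> sk e; have : (off (left_end k) (read s) < k)%N by apply: read_in; lia.
  by rewrite e ltnNge read_notin //; lia.
move=> p q e; apply: val_inj; apply/eqP; rewrite eqn_leq /=; apply/andP.
have pn := Zn_lt n_gt4 p; have qn := Zn_lt n_gt4 q.
by split; rewrite leqNgt; apply/negP => h; [case: (W q p)|case: (W p q)]; rewrite ?h ?e.
Qed.

Definition read_perm := perm read_inj.

Lemma read_prefix u k : (k < n)%N ->
  ((read_perm^-1)%g u <= k)%N = (off (left_end k.+1) u < k.+1)%N.
Proof.
move=> kn; set p := (read_perm^-1)%g u; have eu : u = read p.
  by rewrite -[u](permKV read_perm) permE.
have pn := Zn_lt n_gt4 p; rewrite eu.
case: (leqP p k) => h; first by rewrite read_in //; lia.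
have mono s t x : (0 < s <= t)%N -> (t <= n)%N -> (t <= off (left_end t) x)%N -> (s <= off (left_end s) x)%N.
  move=> /andP[s0]; elim: t => [|t IH]; first by rewrite leqn0 => /eqP->.
  rewrite leq_eqVlt => /orP[/eqP->//|st] tn; rewrite ltnS in st.
  move=> tx; apply: IH => //; first lia.
  by move: tx; rewrite leqNgt read_arc; lia.
apply/esym/negbTE; rewrite -leqNgt.
by apply: (mono _ p); [lia|lia|apply: read_notin; lia].
Qed.

Lemma read_perm_arc : read_perm \in arc_perms n.
Proof.
apply/arc_permsP => k kn; exists (left_end k.+1), k.+1; split=> // u.
exact: read_prefix.
Qed.

(** Positions refine [before] only inside the first and the last block, and the
    two letters of such a block do not form a diagonal. *)
Lemma before_blocks pi : blocks pi = blocks read_perm ->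
  forall u v, polygon_diagonal u v -> before lo u v = (pi^-1%g u < pi^-1%g v)%N.
Proof.
move=> e u v; have pre x k : (k < n - 3)%N -> (pi^-1%g x <= k.+1)%N = (off (lo k) x < k.+2)%N.
  move=> kn; rewrite (blocks_prefix e); last lia.
  rewrite read_prefix; last lia.
  by rewrite /left_end (_ : minn _ _ = k)%N //; lia.
have un := Zn_lt n_gt4 (pi^-1%g u); have vn := Zn_lt n_gt4 (pi^-1%g v).
have un0 := off_lt n_gt4 (lo 0) u; have vn0 := off_lt n_gt4 (lo 0) v.
have un1 := off_lt n_gt4 (lo (n - 4)) u; have vn1 := off_lt n_gt4 (lo (n - 4)) v.
move=> duv; apply/beforeP/idP => [[j [jn ju jv]]|uv].
  have := pre u j jn; have := pre v j jn; rewrite ju ltnNge jv; lia.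
case: (posnP (pi^-1%g v).-1) => [v1|v1].
  exfalso; move: duv; rewrite (polygon_diagonal_base n_gt4 (lo 0)).
  have := pre u 0%N; have := pre v 0%N.
  by case: ifP; lia.
case: (ltnP (pi^-1%g u) (n - 2)) => hu; last first.
  exfalso; move: duv; rewrite (polygon_diagonal_base n_gt4 (lo (n - 4))).
  have := pre u (n - 4)%N; have := pre v (n - 4)%N.
  by case: ifP; lia.
exists (pi^-1%g u).-1; have jn : ((pi^-1%g u).-1 < n - 3)%N by lia.
by split=> //; [rewrite -pre //|rewrite leqNgt -pre //]; lia.
Qed.
End Reading.

Section Words.
Variable T : coloring n.
Hypothesis cT : CTFT T.

Let c : chain (lo T) := @lo_chain n T.

Lemma read_letter i : (0 < i < n - 3)%N -> read (lo T) i.+1 = letter T i.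
Proof.
move=> /andP[i0 iN]; rewrite /read /left_end.
have -> : (minn (i.+2 - 2) (n - 4) = i)%N by lia.
have -> : (minn (i.+1 - 2) (n - 4) = i.-1)%N by lia.
case: i i0 iN => // i _ iN; rewrite /letter /lo /=.
have [km _] := chord_endsP n_gt4 cT (ltnW iN).
case: (chord_ends T i) km => k m /= km; case: (goes_left T i.+1 k m) => /=.
  case: eqP => // h; exfalso; move: h; rewrite -natr1 opprD addrA.
  move/(congr1 (fun x => x + 1)); rewrite subrK => /esym; apply: (add1_neq n_gt4).
by rewrite eqxx -km natrD addrA subrK.
Qed.

Lemma word_read : word T = blocks (read_perm c).
Proof.
set pi := read_perm c.
have piE k : (k < n)%N -> pi k%:R = read (lo T) k.
  by move=> kn; rewrite permE val_natZ.
have lo0 : lo T 0 = base T by rewrite /lo /= subr0.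
have le1 : left_end (lo T) 1 = base T by rewrite /left_end min0n.
have le2 : left_end (lo T) 2 = base T by rewrite /left_end min0n.
set w := ([set base T; base T + 1]%SET
           :: [seq [set letter T i]%SET | i <- iota 1 (n - 4)]).
have ew : w = take (n - 3) (blocks pi).
  rewrite (_ : n - 3 = (n - 4).+1)%N; last lia.
  rewrite /blocks /= -cats1 takel_cat; last by rewrite size_map size_iota.
  rewrite take_oversize; last by rewrite size_map size_iota.
  congr (_ :: _).
    have -> : ([set pi 0; pi 1] = [set pi 0%:R; pi 1%:R])%SET by [].
    rewrite !piE; try lia.
    by rewrite read0 le1 /read le1 le2 eqxx.
  rewrite (iotaDl 1 1) -map_comp; apply/eq_in_map => i; rewrite mem_iota => iN /=.
  by rewrite piE; last lia; rewrite read_letter //; lia.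
rewrite /word -/w.
have -> : (~: (\bigcup_(A <- w) A) = [set pi (n - 2)%:R; pi (n - 1)%:R])%SET.
  apply/setP => u; rewrite in_setC bigcup_has ew take_blocks; last lia.
  rewrite in_pair_perm; try lia.
  have := Zn_lt n_gt4 (pi^-1%g u); move: (nat_of_ord _) => a; move: n_gt4; clear.
  by move=> *; apply/idP/idP; lia.
rewrite ew /blocks /=.
rewrite (_ : n - 3 = (n - 4).+1)%N; last lia.
rewrite /= -!cats1 takel_cat; last by rewrite size_map size_iota.
by rewrite take_oversize // size_map size_iota.
Qed.

(** A class all of whose members have the word of T as blocks exists, because the
    permutation read off T has these blocks and switches preserve them. *)
Lemma perm_classP : (exists pi, pi \in perm_class T) /\
  forall pi, pi \in perm_class T -> blocks pi = word T.
Proof.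
rewrite /perm_class; case: pickP => [C /andP[CA /forall_inP bC]|no] /=.
  split=> [|pi /bC/eqP//]; case/imsetP: CA => x xD ->; exists x.
  by rewrite inE xD connect0.
exfalso; have := no [set y in arc_perms n | connect (@Kswitch n) (read_perm c) y]%SET.
move/negP; apply; apply/andP; split; first by apply/imset_f/read_perm_arc.
apply/forall_inP => pi; rewrite inE word_read => /andP[_ /connectP[s ps ->]].
elim: s (read_perm c) ps => //= y s IH x /andP[xy ys].
by rewrite (Kswitch_blocks xy) IH.
Qed.

Lemma before_perm_class pi : pi \in perm_class T -> forall u v,
  polygon_diagonal u v -> before (lo T) u v = (pi^-1%g u < pi^-1%g v)%N.
Proof.
by move/(proj2 perm_classP); rewrite word_read; apply: before_blocks.
Qed.

Lemma before_total u v : polygon_diagonal u v ->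
  before (lo T) v u = ~~ before (lo T) u v.
Proof.
move=> d; have [[pi pT] _] := perm_classP.
rewrite !(before_perm_class pT) // 1?polygon_diagonal_sym // -leqNgt ltn_neqAle.
case: eqP => // /val_inj/perm_inj e; move: d.
by rewrite e /polygon_diagonal eqxx.
Qed.
End Words.
End ArcPermutations.

(** * Flips *)

Section Flips.
Local Open Scope ring_scope.
Variable n : nat.
Hypothesis n_gt4 : (4 < n)%N.
Implicit Types (p q x y : 'Z_n) (D E t u : {set 'Z_n}) (T S : coloring n).

Lemma chords_nth T D : D \in chords T ->
  (index D T < n - 3)%N /\ nth finset.set0 T (index D T) = D.
Proof.
by rewrite inE => DT; rewrite nth_index // -[X in (_ < X)%N](size_tuple T) index_mem.
Qed.

Lemma flip_nth T S D : CTFT T -> CTFT S -> flip T D S ->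
  [/\ (index D T < n - 3)%N, D = nth finset.set0 T (index D T),
      nth finset.set0 S (index D T) <> D &
      forall j, j <> index D T -> nth finset.set0 S j = nth finset.set0 T j].
Proof.
move=> cT cS /andP[DT /existsP[t /andP[_ /existsP[u /and5P[_ _ _ _ /eqP e]]]]].
have [iD nD] := chords_nth DT.
split=> //; rewrite e; last first.
  by move=> j /eqP ji; rewrite nth_set_nth /= (negbTE ji).
rewrite nth_set_nth /= eqxx => /setP e'.
have /existsP[p /existsP[q /andP[_ /eqP eD]]] := chords_diagonal cT DT.
by have := e' p; rewrite in_setD eD !inE eqxx.
Qed.

Lemma flip_inj T S D E : CTFT T -> CTFT S -> flip T D S -> flip T E S -> D = E.
Proof.
move=> cT cS /(flip_nth cT cS)[i1 e1 n1 a1] /(flip_nth cT cS)[i2 e2 n2 a2].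
case: (index E T =P index D T) => [e|ne]; first by rewrite e1 e2 e.
by case: n2; rewrite a1 // -e2.
Qed.

Lemma triangle_apex A D t : t \in triangles A -> D \subset t -> #|D| = 2%N ->
  exists2 x, x \notin D & t = (x |: D)%SET.
Proof.
rewrite inE => /andP[/eqP t3 _] Dt D2.
have : #|t :\: D| == 1%N by rewrite cardsD (setIidPr Dt) t3 D2.
case/cards1P => x e; exists x.
  by have /setDP[] : x \in (t :\: D)%SET by rewrite e set11.
by rewrite -(setID t D) (setIidPr Dt) e finset.setUC.
Qed.

(** Cutting the quadrangle of the flip along its other diagonal gives two
    triangles of S, and flipping this diagonal returns to T. *)
Lemma flip_sym T S D : CTFT T -> CTFT S -> flip T D S ->
  flip S (nth finset.set0 S (index D T)) T.
Proof.
move=> cT cS f; have [iT eD nD agree] := flip_nth cT cS f.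
case/andP: f => DT /existsP[t /andP[tT /existsP[u /and5P[uT tu Dt Du /eqP eS]]]].
set i := index D T in iT eD nD agree eS *.
set D' := nth finset.set0 S i in nD *.
have eD' : D' = ((t :|: u) :\: D)%SET by rewrite /D' eS nth_set_nth /= eqxx.
have uS : uniq S by case/and3P: cS => _ _ /and3P[].
have iS : index D' S = i by rewrite index_uniq ?size_tuple.
have chS E : E \in chords T -> E != D -> E \in chords S.
  move=> ET ED; have [iE nE] := chords_nth ET.
  rewrite -nE -agree ?mem_chords // => h; move: ED; rewrite -nE h.
  by rewrite {1}eD eqxx.
have D'S : D' \in chords S by apply: mem_chords.
have /existsP[p /existsP[q /andP[/andP[pq _] /eqP Dpq]]] := chords_diagonal cT DT.
have D2 : #|D| = 2%N by rewrite Dpq cards2 pq.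
have [x xD et] := triangle_apex tT Dt D2.
have [y yD eu] := triangle_apex uT Du D2.
have xy : x != y by apply: contra_neq tu => e; rewrite et eu e.
have D'xy : D' = [set x; y]%SET.
  rewrite eD' et eu; apply/setP => z; rewrite !inE.
  case: (z =P x) => [->|_]; first by rewrite xD.
  case: (z =P y) => [->|_]; first by rewrite yD /= orbT.
  by case: (z \in D).
have [pD qD] : p \in D /\ q \in D by rewrite Dpq !inE !eqxx orbT.
have side (v : {set 'Z_n}) z w : v \in triangles (chords T) -> z \notin D -> w \in D ->
    v = (z |: D)%SET -> external [set z; w]%SET || ([set z; w]%SET \in chords S).
  move=> vT zD wD ev; have zw : z != w by apply: contraNneq zD => ->.
  have : [set z; w]%SET \in sides v.
    rewrite inE cards2 zw ev andbT; apply/subsetP => a.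
    by rewrite !inE => /orP[]/eqP->; rewrite ?eqxx ?wD ?orbT.
  move: vT; rewrite inE => /andP[_ /forall_inP h] /h /orP[->//|c].
  by rewrite chS ?orbT //; apply: contraNneq zD => <-; rewrite !inE eqxx.
have tri w : w \in D -> [set w; x; y]%SET \in triangles (chords S).
  move=> wD; have wx : w <> x by move=> e; rewrite -e wD in xD.
  have wy : w <> y by move=> e; rewrite -e wD in yD.
  rewrite inE; apply/andP; split.
    rewrite -finset.setUA cardsU1 cards2 xy !inE.
    by rewrite (introF eqP wx) (introF eqP wy).
  apply/forall_inP => E; rewrite sides3 //; last by apply/eqP.
  case/setUP => [/set2P[]|/set1P] ->.
  - by rewrite finset.setUC; apply: side tT xD wD et.
  - by rewrite -D'xy D'S orbT.
  - by rewrite finset.setUC; apply: side uT yD wD eu.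
apply/andP; split=> //.
apply/existsP; exists [set p; x; y]%SET; rewrite tri //=.
apply/existsP; exists [set q; x; y]%SET; rewrite tri //=.
have neD z w : z \notin D -> w \in D -> (z == w) = false.
  by move=> zD wD; apply: contraNF zD => /eqP->.
have neD' z w : z \notin D -> w \in D -> (w == z) = false.
  by move=> zD wD; rewrite eq_sym neD.
apply/and4P; split.
- apply/eqP => /setP/(_ p); rewrite !inE eqxx (negbTE pq).
  by rewrite !neD'.
- by rewrite D'xy; apply/subsetP => z; rewrite !inE => /orP[]->; rewrite ?orbT.
- by rewrite D'xy; apply/subsetP => z; rewrite !inE => /orP[]->; rewrite ?orbT.
have -> : (([set p; x; y] :|: [set q; x; y]) :\: D' = D)%SET.
  rewrite D'xy Dpq; apply/setP => z; rewrite !inE.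
  case: (z =P x) => [->|_] /=; first by rewrite !neD.
  case: (z =P y) => [->|_] /=; first by rewrite !neD.
  by rewrite !orbF.
rewrite iS eqE /=; apply/eqP/(@eq_from_nth _ finset.set0).
  by rewrite size_set_nth !size_tuple; move: iT; clear; lia.
move=> j _; rewrite nth_set_nth /=; case: eqP => [->//|ji].
by rewrite agree.
Qed.

Definition swapped T S p q := before (lo T) p q && before (lo S) q p
  || before (lo T) q p && before (lo S) p q.

(** H is the chord of whichever side has the arc [p, q) when the other side has
    [p + 1, q + 1). *)
Lemma chain_orientation T S D : CTFT T -> CTFT S ->
  flip T D S ->
  exists2 H, H = D \/ H = nth finset.set0 S (index D T) &
    forall p q, polygon_diagonal p q -> swapped T S p q = (H == [set p; q]%SET).
Proof.
move=> cT cS f; have [iT eD nD agree] := flip_nth cT cS f.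
set i := index D T in iT eD nD agree *.
have loE j : (j < n - 3)%N -> j <> i -> lo T j = lo S j.
  apply: (chain_agree n_gt4 (@lo_chain n T) (@lo_chain n S)) => k kn ki.
  by rewrite -!nth_chord // agree.
have loN : lo T i <> lo S i.
  by move=> e; apply: nD; rewrite nth_chord // /hi -e -/(hi _ _) -nth_chord.
have main lo1 lo2 : chain lo1 -> chain lo2 ->
    (forall j, (j < n - 3)%N -> j <> i -> lo1 j = lo2 j) -> lo2 i = lo1 i + 1 ->
    (forall p q, polygon_diagonal p q -> before lo1 q p = ~~ before lo1 p q) ->
    (forall p q, polygon_diagonal p q -> before lo2 q p = ~~ before lo2 p q) ->
    forall p q, polygon_diagonal p q ->
    before lo1 p q && before lo2 q p || before lo1 q p && before lo2 p q
      = ([set lo1 i; hi lo1 i] == [set p; q])%SET.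
  move=> c1 c2 ag sh t1 t2 p q dpq; have dqp : polygon_diagonal q p.
    by rewrite polygon_diagonal_sym.
  rewrite (t1 p q dpq) (t2 p q dpq); apply/idP/eqP.
    case/orP=> /andP[].
      by move=> b1 b2; have [-> ->] := before_shift_lost n_gt4 c1 c2 iT ag sh dpq b1 b2.
    move=> b1 b2; have [-> ->] := before_shift_gained n_gt4 c1 c2 iT ag sh dpq b2 b1.
    exact: finset.setUC.
  have h1 := before_shift_source n_gt4 lo1 iT.
  have h2 := before_shift_target n_gt4 iT sh.
  case/set2_inj => -[e1 e2]; rewrite e1 e2 in h1 h2.
    by rewrite h1 -(t2 p q dpq) h2.
  by rewrite -(t1 p q dpq) h1 h2 orbT.
have tT := before_total n_gt4 cT; have tS := before_total n_gt4 cS.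
case: (chain_flip_shift n_gt4 (@lo_chain n T) (@lo_chain n S) iT loE loN) => sh.
  exists D; first by left.
  move=> p q dpq; rewrite [D]eD nth_chord //.
  exact: (main _ _ (@lo_chain n T) (@lo_chain n S) loE sh tT tS).
exists (nth finset.set0 S i); first by right.
move=> p q dpq; rewrite nth_chord //.
have loE' j : (j < n - 3)%N -> j <> i -> lo S j = lo T j by move=> *; rewrite loE.
rewrite -(main _ _ (@lo_chain n S) (@lo_chain n T) loE' sh tS tT _ _ dpq).
by rewrite /swapped orbC andbC [X in _ || X]andbC.
Qed.
End Flips.

(** * Chambers *)

From mathcomp Require Import all_classical all_reals all_analysis.
From mathcomp Require Import lra.
Import Order.TTheory Num.Theory.
Import numFieldNormedType.Exports.

Section Chambers.
Local Open Scope classical_set_scope.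
Local Open Scope ring_scope.
Variables (R : realType) (n : nat).
Hypothesis n_gt4 : (4 < n)%N.
Implicit Types (u v : 'Z_n) (pi : {perm 'Z_n}) (T S : coloring n).
Implicit Types (x y : 'rV[R]_(Zp_trunc n).+2).

Lemma complement_neq x u v : arr_complement R n x -> polygon_diagonal u v ->
  x ord0 u <> x ord0 v.
Proof.
move=> [Wx nH] duv e; apply: nH; exists (hyperplane R u v); first by exists u, v.
by split.
Qed.

(** By the intermediate value theorem for x_v - x_u, which has no zero on C. *)
Lemma connected_same_side (C : set 'rV[R]_(Zp_trunc n).+2) x u v :
  connected C -> C `<=` arr_complement R n -> polygon_diagonal u v ->
  C x -> x ord0 u < x ord0 v -> C `<=` [set y | y ord0 u < y ord0 v].
Proof.
move=> conC Ccompl duv Cx xuv y Cy /=; rewrite ltNge; apply/negP => yvu.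
pose f := fun z : 'rV[R]_(Zp_trunc n).+2 => z ord0 v - z ord0 u.
have cf : continuous f.
  move=> z; have cv := @coord_continuous R 1 (Zp_trunc n).+2 ord0 v z.
  by have cu := @coord_continuous R 1 (Zp_trunc n).+2 ord0 u z; exact: (cvgB cv cu).
have : connected (f @` C).
  by apply: connected_continuous_connected => //; apply: continuous_subspaceT.
move/connected_intervalP => /(_ (f y) (f x)) H.
have fxy : f y <= 0 <= f x by rewrite /f subr_le0 yvu subr_ge0 ltW.
have [z Cz /eqP] := H (ex_intro2 _ _ y Cy erefl) (ex_intro2 _ _ x Cx erefl) _ fxy.
by rewrite /f subr_eq0 => /eqP/esym; apply: complement_neq => //; apply: Ccompl.
Qed.

(** The positions of the letters, translated so that they sum to 0. *)
Lemma cone_nonempty pi : cone R pi !=set0.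
Proof.
pose N : R := (Zp_trunc n).+2%:R.
pose c : R := (\sum_(i : 'Z_n) (pi^-1%g i : nat)%:R) / N.
exists (\row_i ((pi^-1%g i : nat)%:R - c)); split.
  rewrite /W /=; under eq_bigr do rewrite mxE.
  rewrite sumrB sumr_const card_ord -mulr_natr divfK ?subrr //.
  by rewrite pnatr_eq0.
by move=> p q pq; rewrite !mxE !permK ltrD2r ltr_nat.
Qed.

(** This set is the chamber of T. Convexity and the inclusion of the cones are
    visible from its inequalities. *)
Definition region T : set 'rV[R]_(Zp_trunc n).+2 :=
  [set x | W R n x /\ forall u v, polygon_diagonal u v -> before (lo T) u v ->
     x ord0 u < x ord0 v].

Lemma cone_region T pi : CTFT T -> pi \in perm_class T -> cone R pi `<=` region T.
Proof.
move=> cT pT x [Wx xpi]; split=> // u v duv.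
rewrite (before_perm_class n_gt4 cT pT duv) => /xpi.
by rewrite !permKV.
Qed.

Lemma region_complement T : CTFT T -> region T `<=` arr_complement R n.
Proof.
move=> cT x [Wx xT]; split=> // -[H [u [v [duv ->]]]] [_ e].
case b : (before (lo T) u v); first by have := xT u v duv b; rewrite e ltxx.
have b' : before (lo T) v u by rewrite before_total ?b.
by have := xT v u; rewrite polygon_diagonal_sym duv b' e ltxx => /(_ isT isT).
Qed.

(** The region is convex, so a segment joins any of its points to x. *)
Lemma region_component T x : CTFT T -> region T x ->
  region T `<=` connected_component (arr_complement R n) x.
Proof.
move=> cT xT y yT.
pose g := fun t : R => x + t *: (y - x).
have cg : continuous g.
  by move=> t; apply: cvgD; [exact: cvg_cst|exact: scalel_continuous].
apply: (@connected_component_max _ _ (g @` `[0, 1])).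
- by exists 0; rewrite /= ?in_itv /= ?lexx ?ler01 // /g scale0r addr0.
- apply: subset_trans (region_complement cT).
  move=> _ [t /= /[!in_itv] /= /andP[t0 t1] <-].
  case: xT yT => [Wx xT] [Wy yT]; split.
    rewrite /W /=; under eq_bigr do rewrite !mxE.
    rewrite big_split /= -big_distrr /= sumrB.
    by rewrite (Wx : \sum_i _ = 0) (Wy : \sum_i _ = 0) subrr mulr0 addr0.
  move=> u v duv b; rewrite !mxE.
  have := xT u v duv b; have := yT u v duv b.
  move: (x ord0 u) (x ord0 v) (y ord0 u) (y ord0 v) => a b' c d cd ab.
  have := mulr_ge0 (_ : 0 <= 1 - t) (_ : 0 <= b' - a).
  rewrite !subr_ge0 t1 (ltW ab) => /(_ isT isT) h1.
  have [t0'|t0'] := ltP 0 t; last by (have -> : t = 0 by lra); lra.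
  by have := mulr_gt0 t0' (_ : 0 < d - c); rewrite subr_gt0 cd => /(_ isT); lra.
- by apply: connected_continuous_connected; [exact: segment_connected|exact: continuous_subspaceT].
- by exists 1; rewrite /= ?in_itv /= ?lexx ?ler01 // /g scale1r addrC subrK.
Qed.

(** The component that contains the region qualifies as the chamber of T. *)
Lemma chamber_ofP T : CTFT T -> chambers R n (chamber_of R T) /\
  forall pi, pi \in perm_class T -> cone R pi `<=` chamber_of R T.
Proof.
move=> cT.
have [[pi pT] _] := perm_classP n_gt4 cT.
have [x xpi] := cone_nonempty pi.
have xT := cone_region cT pT xpi.
apply: (xgetPex (set0 : set 'rV[R]_(Zp_trunc n).+2)
  (P := [set C | chambers R n C /\ forall pi, pi \in perm_class T -> cone R pi `<=` C])).
exists (connected_component (arr_complement R n) x); split.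
  by exists x => //; apply: region_complement xT.
move=> tau tauT; apply: subset_trans (cone_region cT tauT) _.
exact: region_component.
Qed.

Lemma chamber_nonempty T : CTFT T -> chamber_of R T !=set0.
Proof.
move=> cT; have [_ sub] := chamber_ofP cT.
have [[pi pT] _] := perm_classP n_gt4 cT; have [x xpi] := cone_nonempty pi.
by exists x; apply: sub xpi.
Qed.

Lemma chamber_side T u v : CTFT T -> polygon_diagonal u v -> before (lo T) u v ->
  chamber_of R T `<=` [set x | x ord0 u < x ord0 v].
Proof.
move=> cT duv b; have [[z _ eC] sub] := chamber_ofP cT.
have [[pi pT] _] := perm_classP n_gt4 cT; have [x xpi] := cone_nonempty pi.
have [_ xT] := cone_region cT pT xpi.
apply: (@connected_same_side _ x) (xT _ _ duv b) => //; last exact: sub xpi.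
- by rewrite -eC; apply: component_connected.
- by rewrite -eC; apply: connected_component_sub.
Qed.

Lemma separated_swapped T S u v : CTFT T -> CTFT S -> polygon_diagonal u v ->
  separated_by u v (chamber_of R T) (chamber_of R S) <-> swapped T S u v.
Proof.
move=> cT cS duv; have dvu : polygon_diagonal v u by rewrite polygon_diagonal_sym.
have side (U : coloring n) (p q : 'Z_n) : CTFT U -> polygon_diagonal p q ->
    chamber_of R U `<=` [set x | x ord0 p < x ord0 q] -> before (lo U) p q.
  move=> cU dpq h; case bpq : (before (lo U) p q) => //; exfalso.
  have b : before (lo U) q p by rewrite (before_total n_gt4 cU dpq) bpq.
  have [x Ux] := chamber_nonempty cU.
  have := chamber_side cU _ b Ux; rewrite polygon_diagonal_sym => /(_ dpq) /= lt1.
  by have := lt_trans lt1 (h _ Ux); rewrite ltxx.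
split=> [[] [h1 h2]|/orP[] /andP[h1 h2]].
- by rewrite /swapped (side _ _ _ cT duv h1) (side _ _ _ cS dvu h2).
- by rewrite /swapped (side _ _ _ cT dvu h1) (side _ _ _ cS duv h2) orbT.
- by left; split; apply: chamber_side.
- by right; split; apply: chamber_side.
Qed.
End Chambers.

(** Each flip crosses a single wall, which is the hyperplane of the erased chord or
    of the new one; the orientation selects the direction in which it is the
    erased one. *)
Lemma flip_wall (R : realType) (n : nat) (n_gt4 : (4 < n)%N)
    (T S : coloring n) (D : {set 'Z_n}) : CTFT T -> CTFT S -> flip T D S ->
  exists D' H : {set 'Z_n}, [/\ flip S D' T, D <> D', H = D \/ H = D' &
    forall i j : 'Z_n, polygon_diagonal i j ->
      separated_by i j (chamber_of R T) (chamber_of R S) <-> H = [set i; j]%SET].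
Proof.
move=> cT cS f; have [_ _ nD _] := flip_nth cT cS f.
have [H HD Hij] := chain_orientation n_gt4 cT cS f.
exists (nth finset.set0 S (index D T)), H; split=> //.
- exact: flip_sym.
- exact: nesym.
- move=> i j dij; rewrite (separated_swapped R n_gt4 cT cS dij) Hij //.
  by split => /eqP.
Qed.

Lemma asbool_addbl (P Q : Prop) : P -> ~ Q -> `[< P >] (+) `[< Q >].
Proof. by move=> p q; rewrite (asboolT p) (asboolF q). Qed.

Lemma asbool_addbr (P Q : Prop) : ~ P -> Q -> `[< P >] (+) `[< Q >].
Proof. by move=> p q; rewrite (asboolF p) (asboolT q). Qed.

Theorem theorem5p2 (R : realType) (n : nat) :
  (4 < n)%N ->
  exists o : rel (coloring n),
    orientation (@flip_graph n) o /\
    forall T S : coloring n, o T S ->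
      forall i j : 'Z_n, polygon_diagonal i j ->
        (flip T [set i; j]%SET S <->
         separated_by i j (chamber_of R T) (chamber_of R S)).
Proof.
move=> n_gt4.
pose good (T S : coloring n) := forall i j : 'Z_n, polygon_diagonal i j ->
  (flip T [set i; j]%SET S <-> separated_by i j (chamber_of R T) (chamber_of R S)).
have sepC (i j : 'Z_n) (C C' : set 'rV[R]_(Zp_trunc n).+2) : separated_by i j C C' -> separated_by i j C' C.
  by case=> -[]; [right|left].
have goodE (T S : coloring n) (D H : {set 'Z_n}) : CTFT T -> CTFT S -> flip T D S ->
    (forall i j : 'Z_n, polygon_diagonal i j ->
      separated_by i j (chamber_of R T) (chamber_of R S) <-> H = [set i; j]%SET) ->
    good T S <-> H = D.
  move=> cT cS f sepH.
  have fE E : flip T E S <-> D = E by split=> [|<-//]; apply: flip_inj f.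
  have DT : D \in chords T by case/andP: f.
  have /existsP[i /existsP[j /andP[dij /eqP eD]]] := chords_diagonal cT DT.
  split=> [g|e i' j' d].
    by have /(g _ _ dij)/(sepH _ _ dij) -> : flip T [set i; j]%SET S by apply/fE.
  split=> [/fE eD'|/(sepH _ _ d) eH]; first by apply/(sepH _ _ d); rewrite e.
  by apply/fE; rewrite -e.
exists (fun T S => flip_graph T S && `[< good T S >]); split; last first.
  by move=> T S /andP[_ /asboolP].
split=> [T S /andP[]//|T S e].
have e' : flip_graph S T.
  case/and3P: e => cT cS /existsP[D h]; apply/and3P; split=> //.
  by apply/existsP; exists D; rewrite orbC.
rewrite e e' /=.
have main (T' S' : coloring n) (D : {set 'Z_n}) : CTFT T' -> CTFT S' -> flip T' D S' ->
    `[< good T' S' >] (+) `[< good S' T' >].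
  move=> cT cS f; have [D' [H [f' nD HD sepH]]] := flip_wall R n_gt4 cT cS f.
  have g1 := goodE _ _ _ _ cT cS f sepH.
  have g2 : good S' T' <-> H = D'.
    apply: (goodE _ _ _ _ cS cT f') => i j d.
    split=> [/sepC /(sepH i j d)//|h]; apply: sepC.
    exact: (proj2 (sepH i j d) h).
  case: HD => HD; [apply: asbool_addbl|apply: asbool_addbr].
  - exact: (proj2 g1 HD).
  - by move=> /(proj1 g2) h; apply: nD; rewrite -HD.
  - by move=> /(proj1 g1) h; apply: nD; rewrite -HD.
  - exact: (proj2 g2 HD).
case/and3P: e => cT cS /existsP[D /orP[]] f; first exact: (main _ _ _ cT cS f).
by rewrite addbC; apply: (main _ _ _ cS cT f).
Qed.
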